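(* Let $\mathcal M$ be an o-minimal expansion of an ordered group and let $\mathcal M'$ be any expansion of $\mathcal M$ by cuts. Then $\mathcal M'$ is non-valuational if and only if it is an o-minimal trace.
   Context: A cut in an ordered structure $\mathcal M$ is a partition $M=C\cup D$ with $C<D$; by convention $C$ has no maximum. Expanding $\mathcal M$ by a cut $(C,D)$ means adding a unary predicate interpreted as $C$; an expansion by cuts adds such predicates for a family of cuts. (Any expansion of an o-minimal structure by cuts is weakly o-minimal, i.e. every definable subset of its universe is a finite union of convex sets.) ''Definable'' means definable with parameters. A weakly o-minimal expansion of an ordered group is valuational if it has a definable convex subgroup that is non-trivial and proper; otherwise it is non-valuational. A structure $\mathcal M$ is an o-minimal trace if there exists an o-minimal expansion $\mathcal N_0$ of a group, in a language $\mathcal L_0$, such that $M\subsetneq N_0$ is dense in $N_0$, $\mathcal M|\mathcal L_0\prec\mathcal N_0$, and $\mathcal M$ is the structure induced on $M$ from $\mathcal N_0$; in other words, $\mathcal M$ is $\mathcal M|\mathcal L_0$ expanded by all sets $D\cap M^n$ with $D\subseteq N_0^n$ definable (with parameters) in $\mathcal N_0$.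
   Formalization: At least one of the cuts is assumed not definable in M; if all are definable, M' is non-valuational but never an o-minimal trace, since the inclusion of M in N_0 must be proper and dense (e.g. M = M' = (R,<,+)). *)

(* Defs.v *)
From mathcomp Require Import all_boot.
From Stdlib Require List.

Set Implicit Arguments.
Unset Strict Implicit.
Unset Printing Implicit Defensive.

(* Every structure here is ordered, so = and < are treated as logical symbols:
   a language lists only the remaining symbols, by arity, and every sublanguage
   contains <. *)
Record language := Language {
  func : nat -> Type;
  rel : nat -> Type
}.

Record structure (L : language) := Structure {
  carrier :> Type;
  lt : carrier -> carrier -> Prop;
  fint : forall n, func L n -> ('I_n -> carrier) -> carrier;
  rint : forall n, rel L n -> ('I_n -> carrier) -> Prop
}.

Inductive term (L : language) : Type :=
| Var of nat
| App n of func L n & ('I_n -> term L).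

(* Variables are de Bruijn indices: All binds index 0 and shifts the others. *)
Inductive formula (L : language) : Type :=
| Eq of term L & term L
| Lt of term L & term L
| Rel n of rel L n & ('I_n -> term L)
| Bot
| Imp of formula L & formula L
| All of formula L.

Section Semantics.
Variables (L : language) (S : structure L).

Fixpoint eval (e : nat -> S) (t : term L) : S :=
  match t with
  | Var k => e k
  | App _ f ts => fint f (fun i => eval e (ts i))
  end.

Definition push (a : S) (e : nat -> S) (k : nat) : S :=
  if k is k'.+1 then e k' else a.

Fixpoint sat (e : nat -> S) (p : formula L) : Prop :=
  match p with
  | Eq t u => eval e t = eval e u
  | Lt t u => lt (eval e t) (eval e u)
  | Rel _ r ts => rint r (fun i => eval e (ts i))
  | Bot => False
  | Imp p q => sat e p -> sat e q
  | All p => forall a, sat (push a e) p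
  end.

Definition glue n (x : 'I_n -> S) (e : nat -> S) (k : nat) : S :=
  if insub k is Some i then x i else e (k - n).

(* Definability with parameters: variables 0, ..., n-1 carry the point, the later
   ones the parameters e, of which the formula mentions only finitely many. *)
Definition definable n (X : ('I_n -> S) -> Prop) : Prop :=
  exists (p : formula L) (e : nat -> S), forall x, X x <-> sat (glue x e) p.

Definition definable1 (X : S -> Prop) : Prop :=
  definable (fun x : 'I_1 -> S => X (x ord0)).

(* None stands for the infinite endpoint on the corresponding side. *)
Inductive piece := Point of S | Interval of option S & option S.

Definition in_piece (x : S) (P : piece) : Prop :=
  match P with
  | Point a => x = a
  | Interval lo hi =>
      (if lo is Some a then lt a x else True) /\
      (if hi is Some b then lt x b else True)
  end.

Definition o_minimal : Prop :=
  forall X : S -> Prop, definable1 X ->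
    exists s : seq piece, forall x, X x <-> List.Exists (in_piece x) s.

Definition binop (f : func L 2) (x y : S) : S :=
  fint f (fun i => if i == ord0 then x else y).

End Semantics.

(* Written additively; commutativity is not assumed. *)
Record ordered_group (T : Type) (lt : T -> T -> Prop) (add : T -> T -> T)
    (zero : T) (opp : T -> T) : Prop := OrderedGroup {
  og_irrefl : forall x, ~ lt x x;
  og_trans : forall x y z, lt x y -> lt y z -> lt x z;
  og_total : forall x y, lt x y \/ x = y \/ lt y x;
  og_addA : associative add;
  og_add0 : left_id zero add;
  og_addN : left_inverse zero opp add;
  og_lt_addl : forall x y z, lt y z -> lt (add x y) (add x z);
  og_lt_addr : forall x y z, lt y z -> lt (add y x) (add z x)
}.

Definition subgroup (T : Type) (add : T -> T -> T) (zero : T) (opp : T -> T)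
    (H : T -> Prop) : Prop :=
  H zero /\ (forall x y, H x -> H y -> H (add x y)) /\
  (forall x, H x -> H (opp x)).

Definition convex (T : Type) (lt : T -> T -> Prop) (H : T -> Prop) : Prop :=
  forall x y z, H x -> H z -> lt x y -> lt y z -> H y.

Definition valuational (L : language) (S : structure L) (add : S -> S -> S)
    (zero : S) (opp : S -> S) : Prop :=
  exists H : S -> Prop,
    definable1 H /\ convex (@lt L S) H /\ subgroup add zero opp H /\
    (exists x, H x /\ x <> zero) /\ (exists x, ~ H x).

(* A cut (C, D) is represented by C, with D the complement of C. *)
Definition is_cut (T : Type) (lt : T -> T -> Prop) (C : T -> Prop) : Prop :=
  (forall x y, C x -> ~ C y -> lt x y) /\
  (forall x, C x -> exists y, C y /\ lt x y).

Inductive cut_rel (L : language) (I : Type) : nat -> Type :=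
| OldRel n of rel L n : cut_rel L I n
| CutRel of I : cut_rel L I 1.

Definition cut_language (L : language) (I : Type) : language :=
  Language (func L) (cut_rel L I).

Definition cut_rint (L : language) (S : structure L) (I : Type)
    (C : I -> S -> Prop) n (r : cut_rel L I n) : ('I_n -> S) -> Prop :=
  match r in cut_rel _ _ m return ('I_m -> S) -> Prop with
  | OldRel _ r' => rint r'
  | CutRel i => fun x => C i (x ord0)
  end.

Definition expansion_by_cuts (L : language) (S : structure L) (I : Type)
    (C : I -> S -> Prop) : structure (cut_language L I) :=
  @Structure (cut_language L I) S (@lt L S) (@fint L S) (cut_rint C).

Definition sublanguage (L : language) (F0 : forall n, func L n -> Prop)
    (R0 : forall n, rel L n -> Prop) : language :=
  Language (fun n => {f : func L n | F0 n f}) (fun n => {r : rel L n | R0 n r}).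

Definition reduct (L : language) (S : structure L)
    (F0 : forall n, func L n -> Prop) (R0 : forall n, rel L n -> Prop) :
    structure (sublanguage F0 R0) :=
  @Structure (sublanguage F0 R0) S (@lt L S)
    (fun n f => fint (sval f)) (fun n r => rint (sval r)).

Definition elementary (L : language) (S N : structure L) (j : S -> N) : Prop :=
  forall (p : formula L) (e : nat -> S), sat e p <-> sat (fun k => j (e k)) p.

Definition dense_image (L : language) (T : Type) (N : structure L)
    (j : T -> N) : Prop :=
  forall a b : N, lt a b -> exists x : T, lt a (j x) /\ lt (j x) b.

Definition trace_language (L : language) (N : structure L) : language :=
  Language (func L)
    (fun n => (rel L n + {D : ('I_n -> N) -> Prop | definable D})%type).

(* S expanded by the trace on S, along j, of every definable set of N. *)
Definition trace_expansion (L : language) (S N : structure L) (j : S -> N) :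
    structure (trace_language N) :=
  @Structure (trace_language N) S (@lt L S) (@fint L S)
    (fun n r => match r with
                | inl r' => rint r'
                | inr D => fun x => sval D (fun i => j (x i))
                end).

(* The inclusion of the universe of S into that of N is the map j, which is
   injective because it is elementary.  The structures S and the trace expansion
   live in different languages: they are identified when they have the same
   definable sets. *)
Definition o_minimal_trace (L : language) (S : structure L) : Prop :=
  exists (F0 : forall n, func L n -> Prop) (R0 : forall n, rel L n -> Prop)
         (N : structure (sublanguage F0 R0)) (j : reduct S F0 R0 -> N),
    (exists (f : func (sublanguage F0 R0) 2) (zero : N) (opp : N -> N),
       ordered_group (@lt _ N) (binop f) zero opp) /\
    o_minimal N /\
    (exists y : N, forall x, j x <> y) /\
    dense_image j /\
    elementary j /\
    (forall n (X : ('I_n -> S) -> Prop),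
       definable X <-> @definable _ (trace_expansion j) n X).

(* Main.v *)
(* Let M' be the expansion of M by the cuts.

   If M' is the trace of N, every M'-definable set is the trace of an N-definable one:
   a tuple of parameters that is independent over M can be moved freely inside a box
   with corners in M, which eliminates quantifiers over M. So an M'-definable proper
   convex subgroup of M has a supremum d in N, and since M is dense in N, some element
   of the subgroup is moved beyond d by a small translation.

   Conversely, realize all cuts of M in an elementary extension S, and choose by Zorn's
   lemma a maximal A between M and S such that A-definable subsets of S are finite unions
   of points and intervals with endpoints in A, M is dense in A, and the traces on M of
   A-definable sets are M'-definable. If some a in S realized one of the given cuts and
   no element of A did, then dcl(A, a) would be a larger such set. Indeed, the cut of a is
   non-valuational, and near such a cut the o-minimal structure A satisfies uniform bounds:
   a definable family of sets G t that is linearly ordered by inclusion, with all G t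
   nonempty, has a common element for all t near the cut (this bounds distances between
   two A-definable functions of a from below, whence density), and a definable family of
   finite sets has bounded size near the cut (whence o-minimality). *)
Require Import Defs.
From mathcomp Require Import all_boot.
From mathcomp Require Import boolp classical_sets filter.
From Stdlib Require List.

Set Implicit Arguments.
Unset Strict Implicit.
Unset Printing Implicit Defensive.

(** * Definability over a set of parameters *)

(** Realizing a cut that some positive [e] of the group stabilizes would destroy density: if [a]
    realizes it, so does [a + e], and no element of M lies between them. Nonvaluational cuts are
    those with arbitrarily short intervals around them, and the finiteness argument also needs such
    intervals. The elementary extension S is never shown to be o-minimal, which would require bounds
    for arbitrary definable families. Only sets definable over a good A are controlled. Such an A is
    the universe of an o-minimal elementary substructure, so the bounds near one cut can be proved
    inside it and then carried to the new element [a]. A cut that is not definable in M plays two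
    roles: with nonvaluationality it forces M to be dense, and its realization is an element of N
    outside M. In the other direction, the group of N may have an operation different from that of
    M, so the translation that leaves the subgroup has to be bounded uniformly on an interval. *)

Section Renaming.
Variables (L : language) (S : structure L).
Implicit Types (e x y : nat -> S) (p : formula L).

Fixpoint tren (r : nat -> nat) (t : term L) : term L :=
  match t with
  | Var k => Var L (r k)
  | App _ f ts => App f (fun i => tren r (ts i))
  end.

Definition up (r : nat -> nat) (k : nat) := if k is k'.+1 then (r k').+1 else 0.

Fixpoint fren (r : nat -> nat) (p : formula L) : formula L :=
  match p with
  | Eq t u => Eq (tren r t) (tren r u)
  | Lt t u => Lt (tren r t) (tren r u)
  | Rel _ R ts => Rel R (fun i => tren r (ts i))
  | Bot => Bot L
  | Imp p q => Imp (fren r p) (fren r q)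
  | All p => All (fren (up r) p)
  end.

Lemma eval_tren r e t : eval e (tren r t) = eval (fun k => e (r k)) t.
Proof. by elim: t => [k|n f ts IH] //=; congr fint; apply: funext => i. Qed.

Lemma sat_fren r e p : sat e (fren r p) <-> sat (fun k => e (r k)) p.
Proof.
elim: p r e => [t u|t u|n R ts||p IHp q IHq|p IH] r e /=.
- by rewrite !eval_tren.
- by rewrite !eval_tren.
- by under eq_fun do rewrite eval_tren.
- by [].
- by rewrite IHp IHq.
- by split=> h a; move: (h a); rewrite IH; congr sat; apply: funext => -[|k].
Qed.

Lemma eval_finite t :
  exists K, forall e e', (forall k, k < K -> e k = e' k) -> eval e t = eval e' t.
Proof.
elim: t => [k|n f ts IH] /=; first by exists k.+1 => e e' h; apply: h.
have [K hK] := choice IH; exists (\max_i K i) => e e' h; congr fint.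
apply: funext => i; apply: hK => k hk; apply: h.
by apply: leq_trans hk _; apply: leq_bigmax.
Qed.

Lemma sat_finite p :
  exists K, forall e e', (forall k, k < K -> e k = e' k) -> sat e p <-> sat e' p.
Proof.
elim: p => [t u|t u|n R ts||p [K1 h1] q [K2 h2]|p [K h]] /=.
- have [K1 h1] := eval_finite t; have [K2 h2] := eval_finite u.
  exists (maxn K1 K2) => e e' h; rewrite (h1 e e') ?(h2 e e') // => k hk; apply: h;
    by rewrite leq_max hk ?orbT.
- have [K1 h1] := eval_finite t; have [K2 h2] := eval_finite u.
  exists (maxn K1 K2) => e e' h; rewrite (h1 e e') ?(h2 e e') // => k hk; apply: h;
    by rewrite leq_max hk ?orbT.
- have [K hK] := choice (fun i => eval_finite (ts i)).
  exists (\max_i K i) => e e' h.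
  suff -> : (fun i => eval e (ts i)) = (fun i => eval e' (ts i)) by [].
  apply: funext => i; apply: hK => k hk; apply: h.
  by apply: leq_trans hk _; apply: leq_bigmax.
- by exists 0.
- exists (maxn K1 K2) => e e' h.
  rewrite (h1 e e') ?(h2 e e') // => k hk; apply: h;
    by rewrite leq_max hk ?orbT.
- exists K => e e' he.
  have hh a : sat (push a e) p <-> sat (push a e') p.
    by apply: h => -[|k] // hk; apply/he/ltnW.
  by split=> H a; apply/hh.
Qed.

End Renaming.

(* Even variables carry the point, odd ones the parameters. *)
Definition mix (T : Type) (x e : nat -> T) (k : nat) : T := if odd k then e k./2 else x k./2.

(** Renumbering for a quantifier over the first even variable: the bound variable stands in front of
    the whole interleaved environment, so the later even variables and all odd ones change their
    places. *)
Definition bind (k : nat) := if odd k then k.+1 else if k is 0 then 0 else k.-1.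

Section DefinableOver.
Variables (L : language) (S : structure L).
Implicit Types (A B : S -> Prop) (P Q : (nat -> S) -> Prop) (t u : (nat -> S) -> S).

Lemma mix_even (x e : nat -> S) k : mix x e k.*2 = x k.
Proof. by rewrite /mix odd_double doubleK. Qed.

Lemma mix_odd (x e : nat -> S) k : mix x e k.*2.+1 = e k.
Proof. by rewrite /mix /= odd_double uphalf_double. Qed.

Lemma mix_push (a : S) (x e : nat -> S) : mix (push a x) e = (fun k => push a (mix x e) (bind k)).
Proof.
apply: funext => k; rewrite /bind {1}/mix; case: ifP => hk; first by rewrite /push /mix hk.
have -> : k = k./2.*2 by rewrite -[LHS]odd_double_half hk.
case: k./2 => [|m] //=.
by rewrite doubleK; rewrite /mix odd_double doubleK.
Qed.

(* A predicate on environments, of which only finitely many variables matter; the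
   parameters from [A] are the odd variables of the formula. *)
Definition dfn A P :=
  exists (p : formula L) (e : nat -> S),
    (forall k, A (e k)) /\ forall x, P x <-> sat (mix x e) p.

Definition dfun A t := dfn A (fun x => x 0 = t (fun k => x k.+1)).

Definition dcl A (a : S) := dfun A (fun _ => a).

Lemma dfn_ext A P Q : (forall x, P x <-> Q x) -> dfn A P -> dfn A Q.
Proof. by move=> PQ [p [e [he h]]]; exists p, e; split=> // x; rewrite -PQ. Qed.

Lemma dfn_mono A B P : (forall a, A a -> B a) -> dfn A P -> dfn B P.
Proof. by move=> AB [p [e [he h]]]; exists p, e; split=> // k; apply: AB. Qed.

Lemma dfn_inhab A P : dfn A P -> exists a, A a.
Proof. by move=> [p [e [he h]]]; exists (e 0). Qed.

Lemma dfn_ren A P (r : nat -> nat) : dfn A P -> dfn A (fun x => P (fun k => x (r k))).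
Proof.
move=> [p [e [he h]]].
exists (fren (fun k => if odd k then k else (r k./2).*2) p), e; split=> // x.
rewrite h sat_fren; set E := mix _ _; set E' := (X in _ <-> sat X _).
suff -> : E = E' by [].
apply: funext => k; rewrite /E /E' /mix; case: ifP => hk; first by rewrite hk.
by rewrite odd_double doubleK.
Qed.

Lemma dfn_bot A : (exists a, A a) -> dfn A (fun _ => False).
Proof. by move=> [a ha]; exists (Bot L), (fun _ => a). Qed.

Lemma dfn_imp A P Q : dfn A P -> dfn A Q -> dfn A (fun x => P x -> Q x).
Proof.
move=> [p [e [he h]]] [p' [e' [he' h']]].
(* The two parameter sequences are interleaved in [E], those of [p] at even and those of [p'] at odd
   places. *)
pose r1 k := if odd k then k./2.*2.*2.+1 else k.
pose r2 k := if odd k then k./2.*2.+1.*2.+1 else k.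
pose E k := if odd k then e' k./2 else e k./2.
exists (Imp (fren r1 p) (fren r2 p')), E; split=> [k|x /=]; first by rewrite /E; case: ifP.
rewrite h h' !sat_fren.
have E1 : mix x e = fun k => mix x E (r1 k); last have E2 : mix x e' = fun k => mix x E (r2 k); last by rewrite E1 E2.
  apply: funext => k; rewrite /r1; case: ifP => hk; last by rewrite /mix hk.
  by rewrite mix_odd /E odd_double doubleK /mix hk.
apply: funext => k; rewrite /r2; case: ifP => hk; last by rewrite /mix hk.
by rewrite mix_odd /E /= odd_double uphalf_double /mix hk.
Qed.

Lemma dfn_all A (Q : S -> (nat -> S) -> Prop) :
  dfn A (fun x => Q (x 0) (fun k => x k.+1)) -> dfn A (fun x => forall a, Q a x).
Proof.
move=> [p [e [he h]]].
exists (All (fren bind p)), e; split=> // x /=.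
suff H a : Q a x <-> sat (push a (mix x e)) (fren bind p) by split=> H1 a; apply/H.
by rewrite sat_fren -mix_push -h.
Qed.

Lemma dfn_not A P : dfn A P -> dfn A (fun x => ~ P x).
Proof. by move=> h; apply: dfn_imp => //; apply: dfn_bot; apply: dfn_inhab h. Qed.

Lemma dfn_and A P Q : dfn A P -> dfn A Q -> dfn A (fun x => P x /\ Q x).
Proof.
move=> hP hQ; apply: (@dfn_ext _ (fun x => ~ (P x -> ~ Q x))) => [x|].
  by split=> [/not_implyP[? /contrapT]|[? ?]]; [|apply].
by apply/dfn_not/dfn_imp/dfn_not.
Qed.

Lemma dfn_or A P Q : dfn A P -> dfn A Q -> dfn A (fun x => P x \/ Q x).
Proof.
move=> hP hQ; apply: (@dfn_ext _ (fun x => ~ P x -> Q x)) => [x|].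
  by split=> [|[?|?] ?] //; case: (pselect (P x)); [left|right; auto].
by apply/dfn_imp => //; apply/dfn_not.
Qed.

Lemma dfn_iff A P Q : dfn A P -> dfn A Q -> dfn A (fun x => P x <-> Q x).
Proof. by move=> hP hQ; apply: dfn_and; apply: dfn_imp. Qed.

Lemma dfn_ex A (Q : S -> (nat -> S) -> Prop) :
  dfn A (fun x => Q (x 0) (fun k => x k.+1)) -> dfn A (fun x => exists a, Q a x).
Proof.
move=> hQ; apply: (@dfn_ext _ (fun x => ~ forall a, ~ Q a x)) => [x|].
  by rewrite -existsNP; split=> -[a h]; exists a; [apply: contrapT|move/(_ h)].
by apply/dfn_not/dfn_all/dfn_not.
Qed.

Lemma dfn_subst A t (Q : S -> (nat -> S) -> Prop) :
  dfun A t -> dfn A (fun x => Q (x 0) (fun k => x k.+1)) ->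
  dfn A (fun x => Q (t x) x).
Proof.
move=> ht hQ; apply: (@dfn_ext _ (fun x => exists a, a = t x /\ Q a x)) => [x|].
  by split=> [[a [->]]|?] //; exists (t x).
by apply/dfn_ex/dfn_and.
Qed.

Lemma dfun_ren A t (r : nat -> nat) : dfun A t -> dfun A (fun x => t (fun k => x (r k))).
Proof. by move/(dfn_ren (up r)). Qed.

Lemma dfn_reln A n (R : ('I_n -> S) -> Prop) (t : 'I_n -> (nat -> S) -> S) :
  dfn A (fun x => R (fun i => x i)) -> (forall i, dfun A (t i)) ->
  dfn A (fun x => R (fun i => t i x)).
Proof.
move=> hR ht.
(* The arguments are substituted one at a time. The variables of [t i] are shifted by [n], out of
   the way of the arguments still to be replaced. *)
pose U m := fun x => R (fun i : 'I_n => if i < m then t i (fun k => x (n + k)) else x i).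
suff H m : m <= n -> dfn A (U m).
  have := dfn_ren (fun k => k - n) (H n (leqnn n)); apply: dfn_ext => x; rewrite /U.
  suff -> : (fun i : 'I_n => t i x) = (fun i : 'I_n =>
    if i < n then t i (fun k => x (n + k - n)) else x (i - n)) by [].
  apply: funext => i; rewrite ltn_ord; congr t; apply: funext => k.
  by rewrite addKn.
elim: m => [_|m IH hm]; first exact: hR.
pose i0 := Ordinal hm.
pose Q := fun (a : S) (x : nat -> S) => U m (fun k => if k == m then a else x k).
have -> : U m.+1 = (fun x => Q (t i0 (fun k => x (n + k))) x).
  apply: funext => x; rewrite /U /Q /U; congr R; apply: funext => i.
  rewrite ltnS leq_eqVlt; case: eqP => [im|nim] /=.
    rewrite im ltnn; have -> : i = i0 by apply: val_inj.
    by [].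
  case: ifP => // _; congr t; apply: funext => k; case: eqP => // E.
  by move: (hm); rewrite -E ltnNge leq_addr.
apply: (@dfn_subst _ _ Q); first exact: (dfun_ren (fun k => n + k)).
have := dfn_ren (fun k => if k == m then 0 else k.+1) (IH (ltnW hm)).
apply: dfn_ext => x; rewrite /Q.
suff -> : (fun k => x (if k == m then 0 else k.+1)) =
          (fun k => if k == m then x 0 else x k.+1) by [].
by apply: funext => k; case: eqP.
Qed.

Lemma dfn_atom A (p : formula L) :
  (exists a, A a) -> dfn A (fun x => sat (fun k => x k) p).
Proof.
move=> [a ha]; exists (fren double p), (fun _ => a); split=> // x.
rewrite sat_fren; under [X in _ <-> sat X _]eq_fun do rewrite mix_even.
by [].
Qed.

Lemma dfun_var A k : (exists a, A a) -> dfun A (fun x => x k).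
Proof. exact: (@dfn_atom A (Eq (Var L 0) (Var L k.+1))). Qed.

Lemma dcl_sub A a : A a -> dcl A a.
Proof.
move=> ha; exists (Eq (Var L 0) (Var L 1)), (fun _ => a); split=> // x.
Qed.

Lemma dfun_cst A a : dcl A a -> dfun A (fun _ => a).
Proof. by []. Qed.

Lemma dfun_comp A n (g : ('I_n -> S) -> S) (t : 'I_n -> (nat -> S) -> S) :
  dfn A (fun x => x 0 = g (fun i => x i.+1)) -> (forall i, dfun A (t i)) ->
  dfun A (fun x => g (fun i => t i x)).
Proof.
move=> hg ht; rewrite /dfun.
pose R (y : 'I_n.+1 -> S) := y ord0 = g (fun i => y (lift ord0 i)).
pose u (i : 'I_n.+1) (x : nat -> S) : S :=
  if unlift ord0 i is Some i' then t i' (fun k => x k.+1) else x 0.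
have hn : exists a, A a by apply: dfn_inhab hg.
have hu i : dfun A (u i).
  by rewrite /u; case: unliftP => [i' _|_]; [exact: (dfun_ren succn (ht i'))|exact: dfun_var].
apply: dfn_ext (@dfn_reln A n.+1 R u _ hu) => [x|//].
rewrite /R /u unlift_none.
by under [X in _ = g X]eq_fun do rewrite liftK.
Qed.

Lemma dfun_app A n (f : func L n) (t : 'I_n -> (nat -> S) -> S) : (exists a, A a) ->
  (forall i, dfun A (t i)) -> dfun A (fun x => fint f (fun i => t i x)).
Proof.
move=> hn; apply: (@dfun_comp A n (fun y => fint f y)).
exact: (@dfn_atom A (Eq (Var L 0) (App f (fun i : 'I_n => Var L i.+1)))).
Qed.

Lemma dfun_binop A (f : func L 2) t u :
  dfun A t -> dfun A u -> dfun A (fun x => binop f (t x) (u x)).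
Proof.
move=> ht hu.
pose v (i : 'I_2) := if i == ord0 then t else u.
have -> : (fun x => binop f (t x) (u x)) = (fun x => fint f (fun i => v i x)).
  by apply: funext => x; congr fint; apply: funext => i; rewrite /v; case: eqP.
by apply: dfun_app (dfn_inhab ht) _ => i; rewrite /v; case: eqP.
Qed.

Lemma dfn_eq A t u : dfun A t -> dfun A u -> dfn A (fun x => t x = u x).
Proof.
move=> ht hu; apply: (@dfn_subst A t (fun a x => a = u x)) => //.
Qed.

Lemma dfn_rel A n (r : Defs.rel L n) (t : 'I_n -> (nat -> S) -> S) : (exists a, A a) ->
  (forall i, dfun A (t i)) -> dfn A (fun x => rint r (fun i => t i x)).
Proof.
move=> hn; apply: (@dfn_reln A n (fun y => rint r y)).
exact: (@dfn_atom A (Rel r (fun i : 'I_n => Var L i))).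
Qed.

Definition dfn1 A (R : S -> Prop) := dfn A (fun x => R (x 0)).
Definition dfn2 A (R : S -> S -> Prop) := dfn A (fun x => R (x 0) (x 1)).

Lemma dfn1_app A R t : dfn1 A R -> dfun A t -> dfn A (fun x => R (t x)).
Proof.
move=> hR ht; apply: (@dfn_subst A t (fun a _ => R a)) => //.
Qed.

Lemma dfn2_app A R t u :
  dfn2 A R -> dfun A t -> dfun A u -> dfn A (fun x => R (t x) (u x)).
Proof.
move=> hR ht hu; apply: (@dfn_subst A t (fun a x => R a (u x))) => //.
apply: (@dfn_subst A _ (fun a x => R (x 0) a)); first exact: (dfun_ren succn hu).
exact: (dfn_ren (fun k => 1 - k) hR).
Qed.

Lemma dfn_lt A t u : dfun A t -> dfun A u -> dfn A (fun x => lt (t x) (u x)).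
Proof.
move=> ht hu; apply: dfn2_app => //.
by apply: (@dfn_atom A (Lt (Var L 0) (Var L 1))); apply: dfn_inhab ht.
Qed.

End DefinableOver.

(** * Changing the set of parameters *)

Section ParameterSets.
Variables (L : language) (S : structure L).
Implicit Types (A B : S -> Prop) (P Q : (nat -> S) -> Prop) (t u : (nat -> S) -> S).

Lemma push_eta (x : nat -> S) : push (x 0) (fun k => x k.+1) = x.
Proof. by apply: funext => -[]. Qed.

Lemma dfn_prop A (p : Prop) : (exists a, A a) -> dfn A (fun _ => p).
Proof.
move=> hA; case: (pselect p) => hp; last by apply: dfn_ext (dfn_bot hA) => x; split.
by apply: dfn_ext (dfn_imp (dfn_bot hA) (dfn_bot hA)) => x; split.
Qed.

Lemma dfn_push A t Q : dfun A t -> dfn A Q -> dfn A (fun x => Q (push (t x) x)).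
Proof.
move=> ht hQ; apply: (@dfn_subst _ _ _ _ (fun z x => Q (push z x)) ht).
by apply: dfn_ext hQ => x; rewrite push_eta.
Qed.

(** Trades the parameter [a] for a variable: a condition with parameter [a] becomes the member at
    [a] of a family definable over [A]. *)
Lemma dfn_add A a P : (exists b, A b) -> dfn (fun b => A b \/ b = a) P ->
  exists Q, dfn A Q /\ forall x, P x <-> Q (push a x).
Proof.
move=> [b hb] [p [e [he h]]].
(* Parameter places whose value lies outside [A] can only hold [a]; they are redirected to variable
   0, and [b] fills the vacated places. *)
pose r k := if odd k then if `[< A (e k./2) >] then k else 0 else k.+2.
pose e' k := if `[< A (e k) >] then e k else b.
exists (fun x => sat (mix x e') (fren r p)); split.
  by exists (fren r p), e'; split=> // k; rewrite /e'; case: asboolP.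
move=> x; rewrite h sat_fren.
suff -> : mix x e = (fun k => mix (push a x) e' (r k)) by [].
apply: funext => k; rewrite {1}/mix /r; case: ifP => hk; last by rewrite /mix /= negbK hk.
case: asboolP => hA; first by rewrite /mix hk /e'; case: asboolP.
by case: (he k./2).
Qed.

Lemma dfn_finite A P : dfn A P ->
  exists l, (forall a, List.In a l -> A a) /\ dfn (fun a => List.In a l) P.
Proof.
move=> [p [e [he h]]]; have [K hK] := sat_finite S p.
have hmap k n m : m <= k < m + n -> List.In (e k) (map e (iota m n)).
  elim: n m => [|n IH] m /=; first by rewrite addn0 ltnNge; case: leqP.
  case/andP; rewrite leq_eqVlt => /orP[/eqP->|hm hk]; first by left.
  by right; apply: IH; rewrite hm addSnnS.
exists (map e (iota 0 K.+1)); split.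
  by move=> a; elim: (iota 0 K.+1) => //= k s IH [<-|/IH].
exists p, (fun k => if k < K then e k else e 0); split=> [k|x].
  by case: ifP => hk; apply: hmap; rewrite //= ltnW.
rewrite h; apply: hK => k hk; rewrite /mix; case: ifP => // _.
by rewrite (leq_ltn_trans _ hk) // leq_half_double -addnn ltnW ?ltnS ?leq_addr.
Qed.

Lemma dcl_mono A B a : (forall b, A b -> B b) -> dcl A a -> dcl B a.
Proof. exact: dfn_mono. Qed.

(** By the finiteness of the parameters, they can be removed one at a time: each becomes a variable,
    for which its definition over [A] is substituted. *)
Lemma dfn_dcl A P : (exists a, A a) -> dfn (dcl A) P -> dfn A P.
Proof.
move=> hA /dfn_finite [l [hl hP]].
have {hP} : dfn (fun a => A a \/ List.In a l) P by apply: dfn_mono hP => a; right.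
elim: l hl => [|c l IH] hl hP; first by apply: dfn_mono hP => a [|[]].
apply: IH => [a ha|]; first by apply: hl; right.
have hA' : exists a, A a \/ List.In a l by case: hA => a; exists a; left.
have [|Q [hQ hPQ]] := @dfn_add (fun a => A a \/ List.In a l) c P hA'.
  by apply: dfn_mono hP => a /= [?|[->|?]]; auto.
apply: (@dfn_ext _ _ _ (fun x => Q (push c x))) => [x|]; first by rewrite hPQ.
apply: (@dfn_push _ (fun _ => c)) => //.
by apply: (@dcl_mono A) => [b|]; [left|apply: hl; left].
Qed.

(* Tarski-Vaught: [A] is an elementary substructure. *)
Definition tv A := forall P, dfn A P ->
  forall x, (forall k, A (x k)) -> (exists z, P (push z x)) ->
  exists z, A z /\ P (push z x).

Lemma dfn_inst A P (x : nat -> S) : dfn A P -> (forall k, A (x k)) ->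
  dfn1 A (fun z => P (push z x)).
Proof.
move=> [p [e [he h]]] hx.
pose r k := if odd k then k./2.*2.+1.*2.+1 else if k is 0 then 0 else k.-2.*2.+1.
pose e' k := if odd k then e k./2 else x k./2.
exists (fren r p), e'; split=> [k|y]; first by rewrite /e'; case: ifP.
rewrite h sat_fren.
suff -> : mix (push (y 0) x) e = (fun k => mix y e' (r k)) by [].
apply: funext => k; rewrite {1}/mix /r; case: ifP => hk.
  by rewrite mix_odd /e' /= odd_double uphalf_double.
have -> : k = k./2.*2 by rewrite -[LHS]odd_double_half hk.
rewrite doubleK; case: k./2 => [|m] //=.
by rewrite mix_odd /e' odd_double doubleK.
Qed.

Lemma tv_all A P x : tv A -> dfn A P -> (forall k, A (x k)) ->
  (forall z, A z -> P (push z x)) -> forall z, P (push z x).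
Proof.
move=> hA hP hx H z; apply: contrapT => nP.
by have [|w [/H]] := hA _ (dfn_not hP) x hx; first by exists z.
Qed.

Lemma tv_univ A (X : S -> Prop) : tv A -> dfn1 A X -> (forall a, A a -> X a) -> forall a, X a.
Proof.
move=> hA hX h; have [a Aa] := dfn_inhab hX.
exact: (tv_all (x := fun _ => a) hA hX).
Qed.

Lemma definable_dfn n (X : ('I_n -> S) -> Prop) :
  definable X <-> dfn (fun _ => True) (fun x => X (fun i => x i)).
Proof.
have gl (x : 'I_n -> S) e (i : 'I_n) : glue x e i = x i.
  by rewrite /glue; case: insubP => [j _ /val_inj->//|]; rewrite ltn_ord.
have gr (x : 'I_n -> S) e k : glue x e (n + k) = e k.
  by rewrite /glue insubN ?addKn // -leqNgt leq_addr.
split=> [[p [e h]]|[p [e [_ h]]]].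
- exists (fren (fun k => if k < n then k.*2 else (k - n).*2.+1) p), e; split=> // x.
  rewrite h sat_fren; set E := glue _ _; set E' := (X in _ <-> sat X _).
  suff -> : E = E' by [].
  apply: funext => k; rewrite /E /E'; case: ltnP => hk.
    by rewrite mix_even (gl _ _ (Ordinal hk)).
  by rewrite mix_odd -{1}(subnKC hk) gr.
- pose e' k := if k is k'.+1 then e k' else e 0.
  pose r k := if odd k then n + k./2.+1 else if k./2 < n then k./2 else n.
  exists (fren r p), e' => x.
  pose x' k := if insub k is Some i then x i else e 0.
  have <- : (fun i : 'I_n => x' i) = x.
    by apply: funext => i; rewrite /x'; case: insubP => [j _ /val_inj->//|]; rewrite ltn_ord.
  rewrite h sat_fren; set E := mix _ _; set E' := (X in _ <-> sat X _).
  suff -> : E = E' by [].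
  apply: funext => k; rewrite /E /E' /mix /r; case: ifP => hk; first by rewrite gr.
  case: ltnP => hn; first by rewrite (gl _ _ (Ordinal hn)).
  by rewrite -[X in glue _ _ X]addn0 gr /x' insubN // -leqNgt.
Qed.

Lemma definable1_dfn (X : S -> Prop) : definable1 X <-> dfn1 (fun _ => True) X.
Proof. exact: (@definable_dfn 1 (fun x => X (x ord0))). Qed.

End ParameterSets.

(** Comparison of two languages on one universe: once the symbols of the first are definable in the
    second, so is every formula. *)
Lemma dfn_interp (L1 L2 : language) (S : structure L2) lt1 fint1 rint1
    (S1 := @Structure L1 S lt1 fint1 rint1) :
  S -> dfn2 (fun _ : S => True) lt1 ->
  (forall n (f : func L1 n), dfn (fun _ : S => True) (fun x => x 0 = fint1 n f (fun i => x i.+1))) ->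
  (forall n (r : Defs.rel L1 n), dfn (fun _ : S => True) (fun x => rint1 n r (fun i => x i))) ->
  forall p, dfn (fun _ : S => True) (fun x => @sat L1 S1 x p).
Proof.
move=> a0 hlt hf hr; have hn : exists a : S, True by exists a0.
have ht t : dfun (fun _ : S => True) (fun x => @eval L1 S1 x t).
  elim: t => [k|n f ts IH] /=; first exact: dfun_var.
  exact: (@dfun_comp _ _ _ n (fint1 n f) (fun i x => @eval L1 S1 x (ts i))).
elim=> [t u|t u|n r ts||p IHp q IHq|p IH] /=.
- exact: (dfn_eq (ht t) (ht u)).
- exact: (dfn2_app hlt (ht t) (ht u)).
- exact: (@dfn_reln _ _ _ n (rint1 n r) (fun i x => @eval L1 S1 x (ts i))).
- exact: dfn_bot.
- exact: dfn_imp.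
- apply: (@dfn_all _ S _ (fun a x => @sat L1 S1 (@push L1 S1 a x) p)).
  by apply: dfn_ext IH => x; rewrite (@push_eta L1 S1 x).
Qed.

(** * Ordered groups and tame sets *)

(** Proves definability by recursion on the shape of a predicate. A family is recognized as atomic
    only through a hypothesis [dfn1] or [dfn2] about it, which is why auxiliary families are named
    before the call. *)
Ltac defin :=
  rewrite ?/dfn1 ?/dfn2;
  repeat (cbv beta; lazymatch goal with
  | |- dfun _ _ => first
      [ apply dfun_var | apply dfun_cst; solve [assumption | apply: dcl_sub; auto]
      | apply dfun_binop ]
  | |- dfn _ _ => first
      [ match goal with
        | H : dfn1 ?A ?R |- dfn ?A (fun x => ?R (@?t x)) => apply (dfn1_app H)
        | H : dfn2 ?A ?R |- dfn ?A (fun x => ?R (@?t x) (@?u x)) => apply (dfn2_app H)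
        end
      | apply dfn_lt | apply dfn_eq | apply dfn_iff | apply dfn_not
      | apply dfn_and | apply dfn_or | apply dfn_all | apply dfn_ex | apply dfn_imp ]
  | H : exists _, _ |- exists _, _ => exact H
  end).

Section Transitivity.
Variables (T : Type) (r : T -> T -> Prop) (add : T -> T -> T) (zero : T) (opp : T -> T).
Hypothesis hg : ordered_group r add zero opp.

Lemma lt_le_trans x y z : r x y -> ~ r z y -> r x z.
Proof.
move=> xy zy; have [//|[<-|zx]] := og_total hg y z; last by [].
  by move=> yz; apply: og_trans hg _ _ _ xy yz.
exact: xy.
Qed.

Lemma le_lt_trans x y z : ~ r y x -> r y z -> r x z.
Proof.
move=> yx yz; have [//|[->//|//]] := og_total hg x y.
by move=> xy; apply: og_trans hg _ _ _ xy yz.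
Qed.

Lemma le_trans x y z : ~ r y x -> ~ r z y -> ~ r z x.
Proof. by move=> yx zy zx; apply: yx; apply: le_lt_trans zy zx. Qed.

End Transitivity.

(* Decides goals about strict linear orders, with [~ y < x] standing for [x <= y]. *)
Ltac order_with G :=
  intros; apply: contrapT; intro;
  repeat match goal with
  | H : ~ ~ ?P |- _ => apply contrapT in H
  | H : ~ (?P -> ?Q) |- _ => apply not_implyP in H
  | H : ~ (?P /\ ?Q) |- _ => apply not_andP in H
  | H : ~ (?P \/ ?Q) |- _ => apply not_orP in H
  | H : ?P /\ ?Q |- _ => destruct H
  | H : ?P \/ ?Q |- _ => destruct H
  | H : lt ?x ?y -> ?Q |- _ =>
      let h := fresh in
      destruct (pselect (lt x y)) as [h|h]; [specialize (H h) | clear H]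
  | H : ?x <> ?y |- _ => destruct (og_total G x y) as [|[|]]; [| contradiction |]; clear H
  end;
  repeat match goal with
  | H : ?x = ?y |- _ => first [subst x | subst y | rewrite H in *; clear H]
  end;
  try contradiction;
  let add_fact x z pf :=
    lazymatch goal with
    | _ : lt x z |- _ => fail
    | _ => have := pf; intro
    end in
  let add_le x z pf :=
    lazymatch goal with
    | _ : lt x z |- _ => fail
    | _ : ~ lt z x |- _ => fail
    | _ => have := pf; intro
    end in
  repeat match goal with
  | H : lt ?x ?x |- _ => case: (og_irrefl G H)
  | H : lt ?x ?y, H' : ~ lt ?x ?y |- _ => case: (H' H)
  | H1 : lt ?x ?y, H2 : lt ?y ?z |- _ => add_fact x z (og_trans G H1 H2)
  | H1 : lt ?x ?y, H2 : ~ lt ?z ?y |- _ => add_fact x z (lt_le_trans G H1 H2)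
  | H1 : ~ lt ?y ?x, H2 : lt ?y ?z |- _ => add_fact x z (le_lt_trans G H1 H2)
  | H1 : ~ lt ?y ?x, H2 : ~ lt ?z ?y |- _ => add_le x z (le_trans G H1 H2)
  end.

(** * Tame sets and cuts in an ordered group *)

Section Tame.
Variables (L : language) (S : structure L) (add : S -> S -> S) (zero : S) (opp : S -> S).
Hypothesis hg : ordered_group (@lt L S) add zero opp.
Implicit Types (E X K Q R : S -> Prop) (l : seq S) (a b c e m p q s u v w x y z : S).
Local Notation "x < y" := (lt x y).
Local Notation "x + y" := (add x y).
Local Notation "- x" := (opp x).
Local Notation "0" := zero.

Local Ltac order := order_with hg.

Lemma addrN x : x + - x = 0.
Proof.
rewrite -[LHS](og_add0 hg) -{1}(og_addN hg (- x)) -(og_addA hg).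
by rewrite (og_addA hg (- x)) (og_addN hg) (og_add0 hg) (og_addN hg).
Qed.

Lemma addr0 x : x + 0 = x.
Proof. by rewrite -(og_addN hg x) (og_addA hg) addrN (og_add0 hg). Qed.

Lemma addrK x y : x + y + - y = x.
Proof. by rewrite -(og_addA hg) addrN addr0. Qed.

Lemma addrNK x y : x + - y + y = x.
Proof. by rewrite -(og_addA hg) (og_addN hg) addr0. Qed.

Lemma addKr x y : - x + (x + y) = y.
Proof. by rewrite (og_addA hg) (og_addN hg) (og_add0 hg). Qed.

Lemma addNKr x y : x + (- x + y) = y.
Proof. by rewrite (og_addA hg) addrN (og_add0 hg). Qed.

Lemma ltD2l x y z : x + y < x + z <-> y < z.
Proof.
split=> [|/(og_lt_addl hg x)//] /(og_lt_addl hg (- x)).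
by rewrite !addKr.
Qed.

Lemma ltD2r x y z : y + x < z + x <-> y < z.
Proof.
split=> [|/(og_lt_addr hg x)//] /(og_lt_addr hg (- x)).
by rewrite !addrK.
Qed.

Lemma lt_addr_pos x e : x < x + e <-> 0 < e.
Proof. by rewrite -{1}(addr0 x) ltD2l. Qed.

Lemma lt_opp_pos x e : 0 < e -> x + - e < x.
Proof. by move/(og_lt_addl hg (x + - e)); rewrite addrNK addr0. Qed.

Lemma unbounded e : 0 < e -> (forall x, exists y, y < x) /\ (forall x, exists y, x < y).
Proof.
move=> e0; split=> x; first by exists (x + - e); apply: lt_opp_pos.
by exists (x + e); apply/lt_addr_pos.
Qed.

Lemma max2 x y : exists m, (m = x \/ m = y) /\ ~ m < x /\ ~ m < y.
Proof. by case: (pselect (x < y)) => h; [exists y|exists x]; split; auto; split; order. Qed.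

Lemma min2 x y : exists m, (m = x \/ m = y) /\ ~ x < m /\ ~ y < m.
Proof. by case: (pselect (x < y)) => h; [exists x|exists y]; split; auto; split; order. Qed.

(* Equivalently, [X] is a finite union of points and intervals with endpoints in [E]. *)
Definition tame E X := exists l, (forall e, List.In e l -> E e) /\
  forall x y, (forall e, List.In e l -> (x < e <-> y < e) /\ (e < x <-> e < y)) ->
    X x -> X y.

Lemma tame_mono E E' X : (forall e, E e -> E' e) -> tame E X -> tame E' X.
Proof. by move=> h [l [hl H]]; exists l; split=> // e /hl /h. Qed.

Lemma pieces_tame X (s : seq (piece S)) :
  (forall x, X x <-> List.Exists (in_piece x) s) -> tame (fun _ => True) X.
Proof.
move=> h; suff [l hl] : exists l, forall x y,
    (forall e, List.In e l -> (x < e <-> y < e) /\ (e < x <-> e < y)) ->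
    List.Exists (in_piece x) s -> List.Exists (in_piece y) s.
  by exists l; split=> // x y xy hx; apply/(h y); apply: hl xy _; apply/(h x).
elim: s {h} => [|P s [l hl]].
  by exists nil => x y _ h; inversion h.
suff [l' hl'] : exists l, forall x y,
    (forall e, List.In e l -> (x < e <-> y < e) /\ (e < x <-> e < y)) ->
    in_piece x P -> in_piece y P.
  exists (l' ++ l)%list => x y xy /List.Exists_cons[hx|hx]; apply/List.Exists_cons.
    by left; apply: hl' hx => e he; apply/xy/List.in_or_app; left.
  by right; apply: hl hx => e he; apply/xy/List.in_or_app; right.
case: P => [a|lo hi] /=.
  exists (a :: nil) => x y /(_ a (or_introl erefl)) xy ?; subst x.
  case: xy => xy1 xy2; have [h|[//|h]] := og_total hg y a.
    by have := xy1.2 h; order.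
  by have := xy2.2 h; order.
pose o (z : option S) := if z is Some a then a :: nil else nil.
exists (o lo ++ o hi)%list => x y xy [h1 h2]; split.
  case: lo xy h1 => [a|//] xy h1.
  by case: (xy a) => [|_ [/(_ h1)]//]; apply: List.in_or_app; left; left.
case: hi xy h2 => [a|//] xy h2.
by case: (xy a) => [|[/(_ h2)]//]; apply: List.in_or_app; right; left.
Qed.

(** A point lies in the list or in the interval between its neighbours there, one of which may be
    infinite. The pieces are those points and intervals with ends in the list that happen to be
    contained in [X]; empty intervals do no harm. *)
Lemma tame_pieces E X : tame E X ->
  exists s : seq (piece S), List.Forall (fun P => match P with
    | Point a => E a
    | Interval lo hi => (if lo is Some a then E a else True) /\
                        (if hi is Some b then E b else True) end) s /\
  forall x, X x <-> List.Exists (in_piece x) s.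
Proof.
move=> [l [hl H]].
pose inX P := `[< forall x, in_piece x P -> X x >].
pose os := None :: List.map Some l.
pose s := List.filter inX
  (List.map (fun a => Point a) l ++ List.map (fun bd => Interval bd.1 bd.2) (List.list_prod os os))%list.
have hos o : List.In o os -> if o is Some a then List.In a l else True.
  by case=> [<-//|/List.in_map_iff[a [<- ]]].
exists s; split.
  apply/List.Forall_forall => P /List.filter_In[/List.in_app_iff[|] + _].
    by case/List.in_map_iff => a [<- /hl].
  case/List.in_map_iff => -[lo hi] [<- /List.in_prod_iff[/hos h1 /hos h2]] /=.
  by split; [case: lo h1|case: hi h2] => // a /hl.
move=> x; split=> [hx|]; last first.
  by case/List.Exists_exists => P [/List.filter_In[_ /asboolP h] /h].
apply/List.Exists_exists.
have [hin|hnin] := pselect (List.In x l).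
  exists (Point x); split=> //; apply/List.filter_In; split.
    by apply/List.in_app_iff; left; apply: (List.in_map (fun a => Point a)).
  by apply/asboolP => y /= ->.
have [lo [lo1 [lo2 lo3]]] : exists lo, List.In lo os /\
   (if lo is Some a then a < x else True) /\
   forall e, List.In e l -> e < x -> if lo is Some a then ~ a < e else False.
  rewrite /os; elim: l {H hl hnin s os hos} => [|a l [lo [lo1 [lo2 lo3]]]] /=.
    by exists None; split; auto.
  have lo1' : None = lo \/ Some a = lo \/ List.In lo [seq Some i | i <- l].
    by case: lo1; auto.
  case: (pselect (a < x)) => ax; last first.
    by exists lo; split=> //; split=> // e [<-//|]; apply: lo3.
  case: lo lo1 lo1' lo2 lo3 => [b|] lo1 lo1' lo2 lo3; last first.
    exists (Some a); split; auto; split=> // e [<- _|he /(lo3 _ he)//]; order.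
  case: (pselect (a < b)) => ab.
    by exists (Some b); split=> //; split=> // e [<- _|]; [order|apply: lo3].
  exists (Some a); split; auto; split=> // e [<- _|he ex]; first by order.
  by have := lo3 _ he ex; order.
have [hi [hi1 [hi2 hi3]]] : exists hi, List.In hi os /\
   (if hi is Some a then x < a else True) /\
   forall e, List.In e l -> x < e -> if hi is Some a then ~ e < a else False.
  rewrite /os; elim: l {H hl hnin s os hos lo1 lo3} => [|a l [hi [hi1 [hi2 hi3]]]] /=.
    by exists None; split; auto.
  have hi1' : None = hi \/ Some a = hi \/ List.In hi [seq Some i | i <- l].
    by case: hi1; auto.
  case: (pselect (x < a)) => ax; last first.
    by exists hi; split=> //; split=> // e [<-//|]; apply: hi3.
  case: hi hi1 hi1' hi2 hi3 => [b|] hi1 hi1' hi2 hi3; last first.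
    exists (Some a); split; auto; split=> // e [<- _|he /(hi3 _ he)//]; order.
  case: (pselect (b < a)) => ab.
    by exists (Some b); split=> //; split=> // e [<- _|]; [order|apply: hi3].
  exists (Some a); split; auto; split=> // e [<- _|he ex]; first by order.
  by have := hi3 _ he ex; order.
exists (Interval lo hi); split=> //; apply/List.filter_In; split.
  apply/List.in_app_iff; right.
  by apply: (List.in_map (fun bd => Interval bd.1 bd.2) _ (lo, hi)); apply/List.in_prod.
apply/asboolP => y /= [y1 y2]; apply: H hx => e he.
have xe : x <> e by move=> ?; subst e.
have := lo3 e he; have := hi3 e he.
case: lo lo2 {lo1 lo3} y1 => [a|] lo2 y1; case: hi hi2 {hi1 hi3} y2 => [b|] hi2 y2 h1 h2.
all: have [h|[h|h]] := og_total hg x e => //.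
all: try by have := h1 h; split; split; order.
all: try by have := h2 h; split; split; order.
Qed.

Lemma list_min X l x : X x -> (forall y, X y -> List.In y l) ->
  exists m, X m /\ forall y, X y -> ~ y < m.
Proof.
elim: l X x => [|a l IH] X x Xx hl; first by case: (hl x Xx).
case: (pselect (exists y, X y /\ y < a)) => [[y [Xy ya]]|n].
  have [||m [[Xm ma] hm]] := IH (fun z => X z /\ z < a) y; first by split.
    by move=> z [/hl /= h za]; case: h => // E; order.
  by exists m; split=> // z Xz zm; apply: (hm z) => //; split=> //; order.
case: (pselect (X a)) => Xa.
  by exists a; split=> // y Xy ya; apply: n; exists y.
apply: IH Xx _ => y Xy; case: (hl y Xy) => // E.
by case: Xa; rewrite E.
Qed.

Lemma avoid_right l a b : a < b ->
  exists c, a < c /\ ~ b < c /\ forall e, List.In e l -> a < e -> ~ e < c.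
Proof.
move=> ab; elim: l => [|e l [c [ac [cb hc]]]]; first by exists b; split=> //; split=> //; order.
case: (pselect (a < e /\ e < c)) => [[ae ec]|h].
  by exists e; split=> //; split=> [|f [<-|/hc hf] af]; [order|order|have := hf af; order].
by exists c; split=> //; split=> // f [<-|/hc//] af ec; apply: h.
Qed.

Lemma avoid_left l a b : a < b ->
  exists c, c < b /\ ~ c < a /\ forall e, List.In e l -> e < b -> ~ c < e.
Proof.
move=> ab; elim: l => [|e l [c [ac [cb hc]]]]; first by exists a; split=> //; split=> //; order.
case: (pselect (e < b /\ c < e)) => [[ae ec]|h].
  by exists e; split=> //; split=> [|f [<-|/hc hf] af]; [order|order|have := hf af; order].
by exists c; split=> //; split=> // f [<-|/hc//] af ec; apply: h.
Qed.

Lemma tame_right E X a b : tame E X -> a < b ->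
  exists c, a < c /\ ~ b < c /\ forall x y, a < x -> x < c -> a < y -> y < c -> X x -> X y.
Proof.
move=> [l [_ H]] ab; have [c [ac [cb hc]]] := avoid_right l ab.
exists c; split=> //; split=> // x y ax xc ay yc; apply: H => e he.
by have := hc _ he; split; split; order.
Qed.

Lemma tame_left E X a b : tame E X -> a < b ->
  exists c, c < b /\ ~ c < a /\ forall x y, c < x -> x < b -> c < y -> y < b -> X x -> X y.
Proof.
move=> [l [_ H]] ab; have [c [ac [cb hc]]] := avoid_left l ab.
exists c; split=> //; split=> // x y ax xc ay yc; apply: H => e he.
by have := hc _ he; split; split; order.
Qed.

(* A cut that is not realized in [S]. *)
Definition gap_cut K := (forall x y, x < y -> K y -> K x) /\
  (exists x, K x) /\ (exists x, ~ K x) /\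
  (forall x, K x -> exists y, K y /\ x < y) /\
  (forall x, ~ K x -> exists y, ~ K y /\ y < x).

Definition near_cut K (Q : S -> Prop) :=
  exists p q, K p /\ ~ K q /\ forall x, p < x -> x < q -> Q x.

Lemma cut_lt K x y : gap_cut K -> K x -> ~ K y -> x < y.
Proof.
case=> [low _] hx hy; have [//|[E|/low/(_ hx)//]] := og_total hg x y.
by case: hy; rewrite -E.
Qed.

Lemma near_and K Q R : gap_cut K -> near_cut K Q -> near_cut K R -> near_cut K (fun x => Q x /\ R x).
Proof.
move=> hK [p [q [hp [hq h]]]] [p' [q' [hp' [hq' h']]]].
have [m [m1 [m2 m3]]] := max2 p p'; have [n [n1 [n2 n3]]] := min2 q q'.
exists m, n; split; first by case: m1 => ->.
split; first by case: n1 => ->.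
by move=> x mx xn; split; [apply: h|apply: h']; order.
Qed.

Lemma near_mono K Q R : (forall x, Q x -> R x) -> near_cut K Q -> near_cut K R.
Proof. by move=> QR [p [q [hp [hq h]]]]; exists p, q; do 2!split=> //; move=> x px /(h x px)/QR. Qed.

Lemma near_ex K Q : gap_cut K -> near_cut K Q -> exists x, K x /\ Q x.
Proof.
move=> hK [p [q [hp [hq h]]]]; have [_ [_ [_ [/(_ p hp)[x [hx px]] _]]]] := hK.
by exists x; split=> //; apply: h => //; apply: cut_lt hK hx hq.
Qed.

Lemma tame_near E X K : tame E X -> gap_cut K -> near_cut K X \/ near_cut K (fun x => ~ X x).
Proof.
move=> [l [_ H]] hK; have [low [[p0 hp0] [[q0 hq0] [Knomax Knomin]]]] := hK.
have [p [q [hp [hq hpq]]]] : exists p q, K p /\ ~ K q /\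
    forall e, List.In e l -> p < e -> ~ e < q.
  elim: l {H} => [|e l [p [q [hp [hq hpq]]]]]; first by exists p0, q0.
  case: (pselect (K e)) => he.
    have [m [m1 [m2 m3]]] := max2 p e.
    exists m, q; split; first by case: m1 => ->.
    by split=> // f [<-|/hpq hf] mf; [order|apply: hf; order].
  have [m [m1 [m2 m3]]] := min2 q e.
  exists p, m; split=> //; split; first by case: m1 => ->.
  by move=> f [<-|/hpq hf] mf; [order|have := hf mf; order].
have [x [hx px]] := Knomax p hp; have xq := cut_lt hK hx hq.
have hc y z : p < y -> y < q -> p < z -> z < q -> X y -> X z.
  by move=> py yq pz zq; apply: H => e /hpq he; split; split; order.
case: (pselect (X x)) => Xx; [left|right]; exists p, q; do 2!split=> //.
  by move=> y py yq; apply: (hc x).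
by move=> y py yq Xy; apply: Xx; apply: (hc y).
Qed.

Hypothesis dense : forall x y : S, x < y -> exists z, x < z /\ z < y.
Hypothesis nomin : forall x : S, exists y, y < x.
Hypothesis nomax : forall x : S, exists y, x < y.

Lemma tame_finite E X : tame E X ->
  (exists u v, u < v /\ forall x, u < x -> x < v -> X x) \/
  (exists l, forall x, X x -> List.In x l).
Proof.
move=> [l [_ H]].
case: (pselect (forall x, X x -> List.In x l)) => [|/existsNP[x /not_implyP[Xx nx]]].
  by right; exists l.
left; have [[u0 ux] [v0 xv]] := (nomin x, nomax x).
have [v [xv1 [_ hv]]] := avoid_right l xv; have [u [ux1 [_ hu]]] := avoid_left l ux.
exists u, v; split=> [|y uy yv]; first by order.
apply: H Xx => e he; have := hv _ he; have := hu _ he.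
have xe : x <> e by move=> ?; subst.
by split; split; order.
Qed.

Lemma interval_infinite l u v : u < v -> exists x, u < x /\ x < v /\ ~ List.In x l.
Proof.
move=> uv; have [c [uc [cv hc]]] := avoid_right l uv; have [x [ux xc]] := dense uc.
by exists x; split=> //; split; [order|move/hc/(_ ux)].
Qed.

Lemma lower_set_sup K a b : (forall x y, x < y -> K y -> K x) -> K a -> ~ K b ->
  (exists s, ~ s < a /\ ~ b < s /\ (forall x, x < s -> K x) /\ (forall x, s < x -> ~ K x)) \/
  gap_cut K.
Proof.
move=> low ha hb.
have hlt x y : K x -> ~ K y -> x < y.
  move=> hx hy; have [//|[E|/low/(_ hx)//]] := og_total hg x y.
  by case: hy; rewrite -E.
case: (pselect (exists s, K s /\ forall x, s < x -> ~ K x)) => [[s [hs h]]|h1].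
  left; exists s; split; first by move=> sa; apply: h sa ha.
  by split=> [bs|]; [apply: hb; apply: low bs hs|split=> // x xs; apply: low xs hs].
case: (pselect (exists s, ~ K s /\ forall x, x < s -> K x)) => [[s [hs h]]|h2].
  left; exists s; split=> [sa|]; first by apply: hs; apply: low sa ha.
  split=> [bs|]; first by apply: hb; apply: h.
  by split=> // x sx hx; apply: hs; apply: low sx hx.
right; split=> //; split; first by exists a.
split; first by exists b.
split=> x hx; apply: contrapT => n.
  by case: h1; exists x; split=> // y xy hy; case: n; exists y.
by case: h2; exists x; split=> // y xy; apply: contrapT => hy; case: n; exists y.
Qed.

(** Connectedness without assuming definable suprema: let [K] be the set of points up to which [X]
    keeps its value at [x]. A supremum of [K] contradicts local constancy, and a gap is impossible
    because a tame set is constant near a gap. *)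
Lemma tame_locally_constant E X u v : tame E X ->
  (forall z, u < z -> z < v -> exists u' v', u' < z /\ z < v' /\
     forall x y, u' < x -> x < v' -> u' < y -> y < v' -> X x -> X y) ->
  forall x y, u < x -> x < v -> u < y -> y < v -> X x -> X y.
Proof.
move=> hX loc.
have mid x y : x < y -> exists z, x < z /\ z < y by exact: dense.
suff H (x y : S) : u < x -> x < y -> y < v -> X x <-> X y.
  move=> x y ux xv uy yv; have [xy|[->//|yx]] := og_total hg x y.
    by case: (H x y ux xy yv).
  by case: (H y x uy yx xv).
move=> ux xy yv; apply: contrapT => hxy.
pose K z := ~ x < z \/ forall w, x < w -> ~ z < w -> X w <-> X x.
have lowK a b : a < b -> K b -> K a.
  move=> ab [h|h]; first by left; order.
  by right=> w xw wa; apply: h => //; order.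
have Kx : K x by left; order.
have nKy : ~ K y.
  move=> [] // h; apply: hxy; split => ?; apply/(h y) => //; order.
have [[s [sx [ys [below above]]]]|gap] := lower_set_sup lowK Kx nKy; last first.
  have [p [q [hp [hq hpq]]]] : exists p q, K p /\ ~ K q /\ forall y z,
      p < y -> y < q -> p < z -> z < q -> X y <-> X z.
    have [[p [q [hp [hq H]]]]|[p [q [hp [hq H]]]]] := tame_near hX gap;
      exists p, q; do 2!split=> //; move=> b c pb bq pc cq.
      by split=> _; apply: H.
    by split=> ?; [case: (H b)|case: (H c)].
  have [m [m1 [m2 m3]]] := max2 p x.
  have Km : K m by case: m1 => ->.
  have mq := cut_lt gap Km hq.
  have [_ [_ [_ [Knomax Knomin]]]] := gap.
  have [a [Ka ma]] := Knomax m Km; have [b [Kb bq]] := Knomin q hq.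
  have ab := cut_lt gap Ka Kb.
  apply: Kb; right => w xw bw.
  case: (pselect (K w)) => Kw; first by case: (Kw) => [//|hw]; apply: hw => //; order.
  have aw := cut_lt gap Ka Kw.
  have xa : x < a by order.
  have aa : ~ a < a by order.
  case: (Ka) => [//|/(_ a xa aa) hax]; rewrite -hax; apply: hpq; order.
have us : u < s by order.
have sv : s < v by order.
have [u' [v' [u's [sv' huv]]]] := loc s us sv.
have hc w w' : u' < w -> w < v' -> u' < w' -> w' < v' -> X w <-> X w'.
  by move=> *; split; apply: huv.
have [z [sz zv']] := mid _ _ sv'.
apply: (above z sz); right => w xw zw.
case: (pselect (x < s)) => xs.
  have [m [m1 [m2 m3]]] := max2 u' x.
  have ms : m < s by case: m1 => ->.
  have [a [ma as_]] := mid _ _ ms.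
  have xa : x < a by order.
  have aa : ~ a < a by order.
  case: (below a as_) => [//|/(_ a xa aa) hax].
  case: (pselect (w < s)) => ws.
    by case: (below w ws) => [//|/(_ w xw)]; apply; order.
  by rewrite -hax; apply: hc; order.
have E' : s = x by order.
by subst s; apply: hc; order.
Qed.

End Tame.

(** * Uniform bounds near a cut in an o-minimal group *)

Section OMinimal.
Variables (L : language) (S : structure L) (plus : func L 2) (zero : S) (opp : S -> S).
Hypothesis hg : ordered_group (@lt L S) (binop plus) zero opp.
Hypothesis hmin : o_minimal S.
Hypothesis dense : forall x y : S, lt x y -> exists z, lt x z /\ lt z y.
Hypothesis nomin : forall x : S, exists y, lt y x.
Hypothesis nomax : forall x : S, exists y, lt x y.
Implicit Types (K X Q R : S -> Prop) (G W : S -> S -> Prop) (l : seq S).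
Implicit Types (a b c e m p q r s t u v w x y z : S).
Local Notation "x < y" := (lt x y).
Local Notation "x + y" := (binop plus x y).
Local Notation "- x" := (opp x).
Local Notation "0" := zero.
Local Notation all := (fun _ : S => True).

Local Ltac order := order_with hg.

Let inh : exists a : S, True. Proof. by exists 0. Qed.

Lemma omin_tame X : dfn1 all X -> tame all X.
Proof. by move/definable1_dfn/hmin => [l hl]; apply: (pieces_tame hg hl). Qed.

(** A gap is excluded because a definable [K] is tame, hence constant near the gap, yet [K] contains
    the points below it and omits those above. *)
Lemma definable_sup K a b : dfn1 all K -> (forall x y, x < y -> K y -> K x) -> K a -> ~ K b ->
  exists s, ~ s < a /\ ~ b < s /\ (forall x, x < s -> K x) /\ (forall x, s < x -> ~ K x).
Proof.
move=> hK low Ka Kb; have [//|gap] := lower_set_sup hg low Ka Kb.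
have [nK|nK] := tame_near hg (omin_tame hK) gap.
  have [u [v [Ku [Kv H]]]] := nK; have [_ [_ [_ [_ h]]]] := gap.
  have [z [Kz zv]] := h v Kv; have uz := cut_lt hg gap Ku Kz.
  by case: Kz; apply: H.
by have [z [Kz]] := near_ex hg gap nK.
Qed.

Definition nested G :=
  forall t s, (forall u, G t u -> G s u) \/ (forall u, G s u -> G t u).

Lemma nested_pos G : (forall t u v, 0 < v -> v < u -> G t u -> G t v) ->
  nested (fun t u => 0 < u /\ G t u).
Proof.
move=> h t s; apply: contrapT => /not_orP[/existsNP[u /not_implyP[[u0 Gt] ns]]].
move=> /existsNP[v /not_implyP[[v0 Gs] nt]].
have [uv|[E|vu]] := og_total hg u v.
- by apply: ns; split=> //; apply: h Gs.
- by apply: ns; rewrite E.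
- by apply: nt; split=> //; apply: h Gt.
Qed.

Lemma nested_down G : (forall t u v, v < u -> G t u -> G t v) -> nested G.
Proof.
move=> h t s; apply: contrapT => /not_orP[/existsNP[u /not_implyP[Gt ns]]].
move=> /existsNP[v /not_implyP[Gs nt]].
have [uv|[E|vu]] := og_total hg u v.
- by apply: ns; apply: h uv Gs.
- by apply: ns; rewrite E.
- by apply: nt; apply: h vu Gt.
Qed.

Lemma nested_up G : (forall t u v, u < v -> G t u -> G t v) -> nested G.
Proof.
move=> h t s; apply: contrapT => /not_orP[/existsNP[u /not_implyP[Gt ns]]].
move=> /existsNP[v /not_implyP[Gs nt]].
have [uv|[E|vu]] := og_total hg u v.
- by apply: nt; apply: h uv Gt.
- by apply: ns; rewrite E.
- by apply: ns; apply: h vu Gs.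
Qed.

(* Otherwise every level set [G _ u] is finite; the points that are the first of
   some level then form an initial segment of the interval, on which the family
   increases, so that one level contains an interval after all. *)
Lemma uniform_on_subinterval G a b : dfn2 all G -> nested G -> a < b ->
  (forall t, a < t -> t < b -> exists u, G t u) ->
  exists u a' b', ~ a' < a /\ a' < b' /\ ~ b < b' /\ forall t, a' < t -> t < b' -> G t u.
Proof.
move=> hG nG ab ex; apply: contrapT => hn.
have fin u : exists l, forall t, a < t /\ t < b /\ G t u -> List.In t l.
  have ht : tame all (fun t => a < t /\ t < b /\ G t u) by apply: omin_tame; defin.
  have [[a' [b' [ab' H]]]|//] := tame_finite hg nomin nomax ht.
  have [t [at' tb']] := dense ab'; have [at0 [tb0 _]] := H t at' tb'.
  case: hn; have [m [m1 [m2 m3]]] := max2 hg a a'; have [n [n1 [n2 n3]]] := min2 hg b b'.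
  exists u, m, n; split=> //; split; first by case: m1 => E; case: n1 => E'; order.
  split=> // s ms sn.
  by have [||_ [_]] := H s; [order|order|].
pose rcd t := a < t /\ t < b /\ exists u, G t u /\ forall y, a < y -> y < t -> ~ G y u.
have drcd : dfn1 all rcd by rewrite /rcd; defin.
have coinit c : a < c -> c < b -> exists m, rcd m /\ ~ c < m.
  move=> ac cb; have [u Gu] := ex c ac cb; have [l hl] := fin u.
  have [||m [[am [mb Gm]] hm]] := @list_min _ _ _ _ _ hg (fun t => a < t /\ t < b /\ G t u) l c => //.
  exists m; split; last by apply: hm.
  split=> //; split=> //; exists u; split=> // y ay ym Gy.
  by apply: (hm y) => //; split=> //; split=> //; order.
have [d [ad [db hd]]] := tame_right hg (omin_tame drcd) ab.
have [c [ac cd]] := dense ad; have [t0 [at0 t0c]] := dense ac.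
have [|m [Rm cm]] := coinit c ac; first by order.
have R t : a < t -> t < d -> rcd t.
  by move=> at' td; apply: (hd m) => //; [case: Rm|order].
have [_ [_ [u [Gu _]]]] : rcd t0 by apply: R => //; order.
case: hn; exists u, t0, d; split; first by order.
split; [by order|split=> // t t0t td].
have [|_ [_ [v [Gv hv]]]] := R t _ td; first by order.
(* The level of [v] starts at [t], to the right of [t0], so [G t] is not included in [G t0] and the
   inclusion goes the other way. *)
have [h|h] := nG t0 t; first exact: h.
by case: (hv t0 at0 t0t (h v Gv)).
Qed.

(** The radii [r] that work at [x] form a nested family, so one radius serves a whole subinterval,
    which is then cut down to length at most that radius. *)
Lemma uniform_right W a b : dfn2 all W -> a < b ->
  (forall x, a < x -> x < b -> exists r, 0 < r /\ forall y, x < y -> y < x + r -> W x y) ->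
  exists a' b', ~ a' < a /\ a' < b' /\ ~ b < b' /\
    forall x y, a' < x -> x < y -> y < b' -> W x y.
Proof.
move=> hQ ab h; pose G x r := 0 < r /\ forall y, x < y -> y < x + r -> W x y.
have [|||r [a' [b' [aa' [ab' [bb' H]]]]]] := @uniform_on_subinterval G a b _ _ ab.
- by rewrite /G; defin.
- apply: nested_pos => t u v v0 vu H y ty yv; apply: H => //.
  by have /(ltD2l hg t) := vu; order.
- exact: h.
have [t [at' tb']] := dense ab'; have [r0 _] := H t at' tb'.
have ar : a' < a' + r by apply/(lt_addr_pos hg).
have [n [n1 [n2 n3]]] := min2 hg b' (a' + r).
exists a', n; split=> //; split; first by case: n1 => ->.
split=> [|x y ax xy yn]; first by order.
have [|_] := H x ax; first by order.
apply=> //; have /(ltD2r hg r) := ax; order.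
Qed.

Lemma monotone_on_subinterval W a b : dfn2 all W -> (forall x y, W x y \/ W y x) -> a < b ->
  exists a' b', ~ a' < a /\ a' < b' /\ ~ b < b' /\
    ((forall x y, a' < x -> x < y -> y < b' -> W x y) \/
     (forall x y, a' < x -> x < y -> y < b' -> W y x)).
Proof.
move=> hW tot ab.
pose X x := exists r, 0 < r /\ forall y, x < y -> y < x + r -> W x y.
have [|c [ac [bc hc]]] := @tame_right _ _ _ _ _ hg all X a b _ ab.
  by apply: omin_tame; rewrite /X; defin.
have [z [az zc]] := dense ac.
case: (pselect (X z)) => Xz.
  have [x ax xc|a' [b' [h1 [h2 [h3 h4]]]]] := @uniform_right W a c hW ac.
    by apply: (hc z).
  by exists a', b'; split=> //; split=> //; split; [order|left].
have [|x ax xc|a' [b' [h1 [h2 [h3 h4]]]]] := @uniform_right (fun x y => W y x) a c _ ac.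
- by defin.
- have nX : ~ X x by move=> Xx; apply: Xz; apply: (hc x).
  have [|d [xd [dc hd]]] := @tame_right _ _ _ _ _ hg all (W x) x c _ xc.
    by apply: omin_tame; defin.
  exists (- x + d); split; first by apply/(lt_addr_pos hg x); rewrite (addNKr hg).
  rewrite (addNKr hg) => y xy yd; have [Wxy|//] := tot x y; case: nX.
  exists (- x + d); split; first by apply/(lt_addr_pos hg x); rewrite (addNKr hg).
  by rewrite (addNKr hg) => w xw wd; apply: (hd y).
- by exists a', b'; split=> //; split=> //; split; [order|right].
Qed.

(** Transitivity lets [W x] be continued past the supremum of the points up to which it holds. *)
Lemma locally_monotone W p q : (forall x y z, W x y -> W y z -> W x z) -> dfn2 all W ->
  (forall t, p < t -> t < q -> exists u v, u < t /\ t < v /\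
     forall x y, u < x -> x < y -> y < v -> W x y) ->
  forall x y, p < x -> x < y -> y < q -> W x y.
Proof.
move=> tr hW loc x y px xy yq; apply: contrapT => nW.
pose K z := ~ x < z \/ forall w, x < w -> ~ z < w -> W x w.
have hK : dfn1 all K by rewrite /K; defin.
have lowK a b : a < b -> K b -> K a.
  by move=> ab [h|h]; [left; order|right=> w xw wa; apply: h => //; order].
have Kx : K x by left; order.
have nKy : ~ K y by case=> // h; apply/nW/h => //; order.
have [s [sx [ys [below above]]]] := definable_sup hK lowK Kx nKy.
have ps : p < s by order.
have sq : s < q by order.
have [u [v [us [sv huv]]]] := loc s ps sq.
have [z [sz zv]] := dense sv; apply: (above z sz); right => w xw zw.
case: (pselect (x < s)) => xs; last first.
  by have E : s = x by [order]; subst s; apply: huv; order.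
have [m [m1 [m2 m3]]] := max2 hg u x.
have ms : m < s by case: m1 => ->.
have [c [mc cs]] := dense ms.
have Wxc : W x c by case: (below c cs) => [h|]; [order|apply; order].
case: (pselect (c < w)) => cw; first by apply: tr Wxc _; apply: huv; order.
by case: (below c cs) => [h|]; [order|apply].
Qed.

(** The sets [X1] and [X2] of points of local monotonicity are tame, so each holds or fails
    throughout near the gap; both cannot fail, as every interval contains a monotone subinterval. *)
Lemma monotone_near W K : dfn2 all W -> (forall x y, W x y \/ W y x) ->
  (forall x y z, W x y -> W y z -> W x z) -> gap_cut K ->
  exists p q, K p /\ ~ K q /\
    ((forall x y, p < x -> x < y -> y < q -> W x y) \/
     (forall x y, p < x -> x < y -> y < q -> W y x)).
Proof.
move=> hW tot tr gap.
pose X1 t := exists u v, u < t /\ t < v /\ forall x y, u < x -> x < y -> y < v -> W x y.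
pose X2 t := exists u v, u < t /\ t < v /\ forall x y, u < x -> x < y -> y < v -> W y x.
have t1 : tame all X1 by apply: omin_tame; rewrite /X1; defin.
have t2 : tame all X2 by apply: omin_tame; rewrite /X2; defin.
have [[p [q [Kp [Kq H]]]]|n1] := tame_near hg t1 gap.
  by exists p, q; split=> //; split=> //; left; apply: locally_monotone.
have [[p [q [Kp [Kq H]]]]|n2] := tame_near hg t2 gap.
  exists p, q; split=> //; split=> //; right.
  apply: (@locally_monotone (fun x y => W y x)) => //; last by defin.
  by move=> x y z yx zy; apply: tr zy yx.
have [p [q [Kp [Kq H]]]] := near_and hg gap n1 n2.
have pq := cut_lt hg gap Kp Kq.
have [a' [b' [h1 [h2 [h3 h4]]]]] := monotone_on_subinterval hW tot pq.
have [t [at' tb']] := dense h2.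
have [||nX1 nX2] := H t; try by order.
by case: h4 => h4; [case: nX1|case: nX2]; exists a', b'.
Qed.

(** Inclusion is a total preorder on the fibres, hence monotone near the gap. An element of a single
    fibre, taken below the gap if the fibres increase and above it if they decrease, belongs to all
    fibres between that one and the far side of the gap. *)
Lemma uniform_near G K : dfn2 all G -> nested G -> gap_cut K ->
  near_cut K (fun t => exists u, G t u) -> exists u, near_cut K (fun t => G t u).
Proof.
move=> hG nG gap [p0 [q0 [Kp0 [Kq0 ex]]]].
have [||p [q [Kp [Kq H]]]] := @monotone_near (fun t s => forall u, G t u -> G s u) K _ nG _ gap.
- by defin.
- by move=> x y z h h' u /h/h'.
have [m [m1 [m2 m3]]] := max2 hg p p0; have [n [n1 [n2 n3]]] := min2 hg q q0.
have Km : K m by case: m1 => ->.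
have Kn : ~ K n by case: n1 => ->.
have [_ [_ [_ [Knomax Knomin]]]] := gap.
have [t [Kt mt]] := Knomax m Km; have [s [Ks sn]] := Knomin n Kn.
have ts := cut_lt hg gap Kt Ks.
case: H => H.
  have [||u Gu] := ex t; try by order.
  exists u, t, n; split=> //; split=> // x tx xn.
  by apply: (H t x) => //; order.
have [||u Gu] := ex s; try by order.
exists u, m, s; split=> //; split=> // x mx xs.
by apply: (H x s) => //; order.
Qed.

(** * Finiteness of fibres near a cut *)

(** A first-order form of having at least [n] elements above [y], so that bounds on cardinality are
    definable conditions on the parameter of a family. *)
Fixpoint chain n X y : Prop :=
  if n is n'.+1 then exists z, y < z /\ X z /\ chain n' X z else True.

Lemma chain_size n X y l : (forall w, y < w -> X w -> List.In w l) ->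
  chain n X y -> (n <= size l)%N.
Proof.
elim: n y l => [//|n IH] y l hl /= [z [yz [Xz hz]]].
have [l1 [l2 E]] := List.in_split _ _ (hl z yz Xz).
rewrite E size_cat /= addnS ltnS -size_cat; apply: IH hz => w zw Xw.
have : List.In w l by apply: hl => //; order.
rewrite E => /List.in_app_iff[h|[h|h]]; apply/List.in_app_iff; [by left|order|by right].
Qed.

Lemma list_uniform_pos (P : S -> S -> Prop) l :
  (forall y u v, 0 < v -> v < u -> P y u -> P y v) ->
  (forall y, List.In y l -> exists r, 0 < r /\ P y r) ->
  exists r, 0 < r /\ forall y, List.In y l -> P y r.
Proof.
move=> down; elim: l => [_|a l IH h].
  by have [r r0] := nomax 0; exists r.
have [|r [r0 hr]] := IH; first by move=> y hy; apply: h; right.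
have [|s [s0 hs]] := h a; first by left.
have [m [m1 [m2 m3]]] := min2 hg r s.
exists m; split=> [|y /= hy]; first by case: m1 => ->.
case: hy => [<-|hy].
  by have [ms|[->//|//]] := og_total hg m s; apply: down hs => //; case: m1 => ->.
have [mr|[->|//]] := og_total hg m r; last exact: hr.
by apply: down (hr y hy) => //; case: m1 => ->.
Qed.

Lemma finite_gap X l : (forall y, X y -> List.In y l) ->
  exists r, 0 < r /\ forall y z, X y -> X z -> y < z -> ~ z < y + r.
Proof.
move=> hl.
have [||r [r0 hr]] := @list_uniform_pos (fun y r => forall z, X z -> y < z -> ~ z < y + r) l.
- by move=> y u v v0 /(ltD2l hg y) uv H z Xz /(H z Xz); order.
- move=> y hy; have [b yb] := nomax y; have [c [yc [cb hc]]] := avoid_right hg l yb.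
  exists (- y + c); rewrite (addNKr hg); split=> [|z /hl/hc//].
  by apply/(lt_addr_pos hg y); rewrite (addNKr hg).
by exists r; split=> // y z /hl/hr; apply.
Qed.

(** In place of divisibility: [r] is the sum of [x] and [- x + r] for some [x] strictly between, and
    the smaller summand is taken. *)
Lemma half_pos r : 0 < r -> exists s, 0 < s /\ ~ r < s + s.
Proof.
move=> r0; have [x [x0 xr]] := dense r0.
have [m [m1 [m2 m3]]] := min2 hg x (- x + r).
exists m; split.
  case: m1 => -> //; apply/(ltD2l hg x).
  by rewrite (addNKr hg) (addr0 hg).
have E : x + (- x + r) = r by rewrite (addNKr hg).
have h1 : ~ x + m < m + m by move/(ltD2r hg).
have h2 : ~ x + (- x + r) < x + m by move/(ltD2l hg).
by rewrite E in h2; order.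
Qed.

Lemma near_shrink K Q r : gap_cut K ->
  (forall r, 0 < r -> exists p q, K p /\ ~ K q /\ ~ p + r < q) ->
  0 < r -> near_cut K Q -> exists p q, K p /\ ~ K q /\ ~ p + r < q /\
    forall x, p < x -> x < q -> Q x.
Proof.
move=> gap nv r0 [p [q [Kp [Kq H]]]]; have [p' [q' [Kp' [Kq' H']]]] := nv r r0.
have [m [m1 [m2 m3]]] := max2 hg p p'; have [n [n1 [n2 n3]]] := min2 hg q q'.
exists m, n; split; first by case: m1 => ->.
split; first by case: n1 => ->.
split=> [|x mx xn]; last by apply: H; order.
have h : ~ m + r < p' + r by move/(ltD2r hg).
by order.
Qed.

Definition within r y z := y < z + r /\ z < y + r.

(** Distinct points of [X] are at least [r] apart, so moving each by less than [s], where twice [s]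
    is at most [r], preserves their order. *)
Lemma chain_within n (X Y : S -> Prop) r s :
  0 < s -> ~ r < s + s -> (forall y z, X y -> X z -> y < z -> ~ z < y + r) ->
  (forall y, X y -> exists z, Y z /\ within s y z) ->
  forall y y', X y -> within s y y' -> chain n X y -> chain n Y y'.
Proof.
move=> s0 sr gapX XY; elim: n => [//|n IH] y y' Xy [yy' y'y] [z [yz [Xz hz]]].
have [z' [Yz' wz']] := XY z Xz; exists z'; split; last by split=> //; apply: IH wz' hz.
have h1 := gapX y z Xy Xz yz; case: wz' => zz' _.
have h2 : ~ y + r < y + (s + s) by move/(ltD2l hg).
have : y' + s < y + s + s by apply/(ltD2r hg).
rewrite -(og_addA hg) => h3; apply/(ltD2r hg s); order.
Qed.

(* Gaps of the fibres are bounded below near [K]. If points of the fibres kept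
   disappearing immediately to the right, then the disappearing ones, one for each
   [t], would be far apart, so their union would be a finite set with infinitely many
   elements. Hence they persist, and a fibre to the right of [K] bounds all others. *)
Lemma finite_near (B : S -> S -> Prop) K : dfn2 all B -> gap_cut K ->
  (forall r, 0 < r -> exists p q, K p /\ ~ K q /\ ~ p + r < q) ->
  (forall t, exists l, forall y, B t y -> List.In y l) ->
  exists n, near_cut K (fun t => forall z, B t z -> ~ chain n (B t) z).
Proof.
move=> hB gap nv fin.
have nearT : near_cut K (fun _ => True).
  by have [_ [[x Kx] [[y Ky] _]]] := gap; exists x, y.
pose G1 t r := 0 < r /\ forall y z, B t y -> B t z -> y < z -> ~ z < y + r.
have [|||r nG1] := @uniform_near G1 K _ _ gap.
- by rewrite /G1; defin.
- apply: nested_pos => t u v v0 vu H y z By Bz yz.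
  by have := H y z By Bz yz; have /(ltD2l hg y) := vu; order.
- apply: near_mono nearT => t _; have [l hl] := fin t.
  exact: finite_gap hl.
have [_ [_ [r0 _]]] := near_ex hg gap nG1.
have [s [s0 sr]] := half_pos r0.
have wsym y z : within s y z -> within s z y by case.
pose lost t d := exists y, B t y /\ forall x, t < x -> x < t + d ->
  forall z, B x z -> ~ within s y z.
have hlost : tame all (fun t => exists d, 0 < d /\ lost t d).
  by apply: omin_tame; rewrite /lost /within; defin.
have [nlost|nkeep] := tame_near hg hlost gap.
- have [||d nd] := @uniform_near (fun t d => 0 < d /\ lost t d) K _ _ gap nlost.
  + by rewrite /lost /within; defin.
  + apply: nested_pos => t u v v0 /(ltD2l hg t) vu [y [By H]].
    by exists y; split=> // x tx xv; apply: H => //; order.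
  have [_ [_ [d0 _]]] := near_ex hg gap nd.
  have [p [q [Kp [Kq [pq H]]]]] := near_shrink gap nv d0 (near_and hg gap nG1 nd).
  have {}pq' := cut_lt hg gap Kp Kq.
  (* The interval from [p] to [q] has length at most [d], so a point lost between [t] and [t + d] is
     lost on all the rest of it. *)
  pose Zt t y := p < t /\ t < q /\ B t y /\
    forall x, t < x -> x < q -> forall z, B x z -> ~ within s y z.
  have apart t t' y z : Zt t y -> Zt t' z -> t < t' -> ~ within s y z.
    by move=> [_ [_ [_ h]]] [_ [tq [Bz _]]] tt'; apply: h tt' tq _ Bz.
  pose Z y := exists t, Zt t y.
  have hZ : tame all Z by apply: omin_tame; rewrite /Z /Zt /within; defin.
  have [[u [v [uv hv]]]|[l hl]] := tame_finite hg nomin nomax hZ.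
    (* Two points of [Z] closer than [s] are contradictory: for different [t] the earlier point
       would not be lost, and within one fibre points are at least [r] apart. *)
    have [y [uy yv]] := dense uv.
    have ys : y < y + s by apply/(lt_addr_pos hg).
    have [m [m1 [m2 m3]]] := min2 hg v (y + s).
    have ym : y < m by case: m1 => ->.
    have [z [yz zm]] := dense ym.
    have zs : z < z + s by apply/(lt_addr_pos hg).
    have wyz : within s y z by split; order.
    have [t ty] := hv y uy yv.
    have [||t' tz] := hv z; try by order.
    have [tt'|[E|tt']] := og_total hg t t'.
    + by case: (apart _ _ _ _ ty tz tt').
    + subst t'; case: ty => [pt [tq [By _]]]; case: tz => [_ [_ [Bz _]]].
      have [[_ h] _] := H t pt tq; have := h y z By Bz yz.
      have ss : s < s + s by apply/(lt_addr_pos hg).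
      have : y + s < y + (s + s) by apply/(ltD2l hg).
      have : ~ y + r < y + (s + s) by move/(ltD2l hg).
      by order.
    + by case: (apart _ _ _ _ tz ty tt'); apply: wsym.
  (* A lost point determines its [t]. If [Z] were finite, [g] would map it onto an infinite
     interval. *)
  have [g hgt] : exists g : S -> S, forall t y, Zt t y -> g y = t.
    have /choice[g hgt] : forall y, exists t, forall t', Zt t' y -> t = t'.
      move=> y; case: (pselect (exists t, Zt t y)) => [[t ty]|n]; last first.
        by exists 0 => t' ty; case: n; exists t'.
      exists t => t' ty'.
      have wyy : within s y y by split; apply/(lt_addr_pos hg).
      have [tt'|[//|tt']] := og_total hg t t'.
        by case: (apart _ _ _ _ ty ty' tt').
      by case: (apart _ _ _ _ ty' ty tt').
    by exists g => t y /hgt.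
  have [t [pt [tq]]] := interval_infinite hg dense (List.map g l) pq'.
  case; have [_ [_ [y [By hy]]]] := H t pt tq.
  have ty : Zt t y.
    split=> //; split=> //; split=> // x tx xq; apply: hy => //.
    by have /(ltD2r hg d) := pt; order.
  by apply/List.in_map_iff; exists y; split; [apply: hgt|apply: hl; exists t].
- pose keep t d := forall y, B t y -> forall x, t < x -> x < t + d ->
    exists z, B x z /\ within s y z.
  have [|||d nd] := @uniform_near (fun t d => 0 < d /\ keep t d) K _ _ gap.
  + by rewrite /keep /within; defin.
  + apply: nested_pos => t u v v0 /(ltD2l hg t) vu H y By x tx xv.
    by apply: H => //; order.
  + apply: near_mono nkeep => t nl; have [l hl] := fin t.
    have [||d [d0 hd]] := @list_uniform_pos (fun y d => B t y -> forall x, t < x -> x < t + d ->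
      exists z, B x z /\ within s y z) l.
    * move=> y u v v0 /(ltD2l hg t) vu H By x tx xv.
      by apply: H => //; order.
    * move=> y hy; case: (pselect (B t y)) => By; last first.
        by have [d d0] := nomax 0; exists d.
      have hX : tame all (fun x => exists z, B x z /\ within s y z).
        by apply: omin_tame; rewrite /within; defin.
      have [b tb] := nomax t; have [c [tc [cb hc]]] := tame_right hg hX tb.
      have d0 : 0 < - t + c by apply/(lt_addr_pos hg t); rewrite (addNKr hg).
      exists (- t + c); split=> // _ x tx; rewrite (addNKr hg) => xc.
      apply: contrapT => nx; apply: nl; exists (- t + c); split=> //; exists y; split=> //.
      move=> x'; rewrite (addNKr hg) => tx' xc' z Bz wz; apply: nx.
      by apply: (hc x') => //; exists z.
    by exists d; split=> // y By; apply: hd => //; apply: hl.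
  have [_ [_ [d0 _]]] := near_ex hg gap nd.
  have [p [q [Kp [Kq [pq H]]]]] := near_shrink gap nv d0 (near_and hg gap nG1 nd).
  have [_ [_ [_ [_ Knomin]]]] := gap; have [t0 [Kt0 t0q]] := Knomin q Kq.
  have [l hl] := fin t0.
  (* Since [t0] is above the cut, fibres between [p] and [t0] persist up to [t0], and chains in them
     move into the fibre of [t0], whose points are listed in [l]. *)
  exists (size l).+1, p, t0; split=> //; split=> // t pt tt0 z Bz hz.
  have [|[_ hgap] [_ hkeep]] := H t pt; first by order.
  have hk y : B t y -> exists z, B t0 z /\ within s y z.
    by move=> By; apply: hkeep => //; have /(ltD2r hg d) := pt; order.
  have [z' [Bz' wz]] := hk z Bz.
  have := chain_within s0 sr hgap hk Bz wz hz.
  by move/(@chain_size _ _ _ l); rewrite ltnn => h; suff : false by []; apply: h => w _ /hl.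
Qed.

End OMinimal.

(** * Elementary embeddings *)

Section Elementary.
Variables (L : language) (S0 S : structure L) (j : S0 -> S).
Hypothesis hj : elementary j.

Lemma elementary_eq x y : x = y <-> j x = j y.
Proof. exact: (hj (Eq (Var L 0) (Var L 1)) (fun k => if k is 0 then x else y)). Qed.

Lemma elementary_lt x y : lt x y <-> lt (j x) (j y).
Proof. exact: (hj (Lt (Var L 0) (Var L 1)) (fun k => if k is 0 then x else y)). Qed.

Lemma elementary_fint n (f : func L n) (x : 'I_n -> S0) :
  j (fint f x) = fint f (fun i => j (x i)).
Proof.
pose e k := if insub k is Some i then x i else fint f x.
have ei (i : 'I_n) : e i = x i.
  by rewrite /e; case: insubP => [i' _ /val_inj->//|]; rewrite ltn_ord.
have en : e n = fint f x by rewrite /e insubF ?ltnn.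
have := hj (Eq (Var L n) (App f (fun i : 'I_n => Var L i))) e.
rewrite /= en; under eq_fun do rewrite ei.
by under [X in _ <-> _ = fint f X]eq_fun do rewrite ei; case=> ->.
Qed.

Lemma elementary_binop (f : func L 2) x y : j (binop f x y) = binop f (j x) (j y).
Proof.
by rewrite /binop elementary_fint; congr fint; apply: funext => i; case: eqP.
Qed.

Lemma elementary_rint n (r : Defs.rel L n) (x : 'I_n -> S0) :
  S0 -> rint r x <-> rint r (fun i => j (x i)).
Proof.
move=> a; pose e k := if insub k is Some i then x i else a.
have ei (i : 'I_n) : e i = x i.
  by rewrite /e; case: insubP => [i' _ /val_inj->//|]; rewrite ltn_ord.
have := hj (Rel r (fun i : 'I_n => Var L i)) e; rewrite /=.
have -> : (fun i : 'I_n => e i) = x by apply: funext.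
by have -> : (fun i : 'I_n => j (e i)) = (fun i => j (x i)) by apply: funext => i; rewrite ei.
Qed.

Lemma elementary_tv : tv (fun b => exists a, j a = b).
Proof.
move=> P [p [e [he h]]] x hx [z Pz].
have [e0 he0] := choice he; have [x0 hx0] := choice hx.
have Er (T : structure L) a (y d : nat -> T) :
    sat (mix (push a y) d) p <-> sat (push a (mix y d)) (fren bind p).
  by rewrite sat_fren -mix_push.
have := hj (Imp (All (Imp (fren bind p) (Bot L))) (Bot L)) (mix x0 e0).
have -> : (fun k => j (mix x0 e0 k)) = mix x e.
  by apply: funext => k; rewrite /mix; case: ifP.
case=> _ /=; have nn : ~ forall a, sat (push a (mix x e)) (fren bind p) -> False.
  by move/(_ z); apply; apply/Er/(h (push z x)).
move=> /(_ nn) /existsNP[a /contrapT ha]; exists (j a); split; first by exists a.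
apply/(h (push (j a) x))/Er.
have /hj := ha; congr sat; apply: funext => -[|k] //=.
by rewrite /mix; case: ifP.
Qed.

Lemma dfn_pull P : dfn (fun b => exists a, j a = b) P ->
  dfn (fun _ : S0 => True) (fun x => P (fun k => j (x k))).
Proof.
move=> [p [e [he h]]]; have [e0 he0] := choice he.
exists p, e0; split=> // x; rewrite h hj.
suff -> : mix (fun k => j (x k)) e = (fun k => j (mix x e0 k)) by [].
by apply: funext => k; rewrite /mix; case: ifP.
Qed.

Lemma sat_iter_all (T : structure L) n p (e v : nat -> T) : sat e (iter n (@All L) p) ->
  sat (fun k => if k < n then v k else e (k - n)) p.
Proof.
elim: n e => [|n IH] e /= h.
  by rewrite (_ : (fun k => _) = e) //; apply: funext => k; rewrite subn0.
have := IH _ (h (v n)); congr sat; apply: funext => k.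
case: (ltngtP k n) => [kn|nk|->]; first by rewrite ltnS ltnW.
  rewrite ltnNge nk /= -(subnSK nk) //.
by rewrite ltnS leqnn subnn.
Qed.

(** The embedding only speaks about environments with values in its image; the universal closure
    over the finitely many relevant variables removes this restriction. *)
Lemma elementary_valid p : S0 -> (forall e : nat -> S0, sat e p) <-> (forall e : nat -> S, sat e p).
Proof.
move=> a; split=> h e; last exact/hj.
have [K hK] := sat_finite S p.
have hall n : forall e : nat -> S0, sat e (iter n (@All L) p) by elim: n => //= n IH e' b.
have /hj/(sat_iter_all e) := hall K (fun _ => a).
by apply: (iffLR (hK _ _ _)) => k ->.
Qed.

End Elementary.

Definition tadd (L : language) (plus : func L 2) (t u : term L) : term L :=
  App plus (fun i => if i == ord0 then t else u).
Arguments tadd : simpl never.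

Definition Ex (L : language) (p : formula L) := Imp (All (Imp p (Bot L))) (Bot L).
Arguments Ex : simpl never.

Lemma eval_tadd (L : language) (plus : func L 2) (T : structure L) (e : nat -> T) t u :
  eval e (tadd plus t u) = binop plus (eval e t) (eval e u).
Proof. by rewrite /tadd /= /binop; congr fint; apply: funext => i; case: eqP. Qed.

Lemma sat_ex (L : language) (T : structure L) (e : nat -> T) (p : formula L) :
  sat e (Ex p) <-> exists a, sat (push a e) p.
Proof.
rewrite /Ex /=; split=> [h|[a ha] h]; last exact: h ha.
by apply: contrapT => n; apply: h => a ha; apply: n; exists a.
Qed.

Lemma satE (L : language) (T : structure L) (e : nat -> T) :
  (forall t u, sat e (Eq t u) = (eval e t = eval e u)) *
  (forall t u, sat e (Lt t u) = lt (eval e t) (eval e u)) *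
  (forall p q, sat e (Imp p q) = (sat e p -> sat e q)).
Proof. by []. Qed.

Section GroupTransfer.
Variables (L : language) (S1 S2 : structure L) (plus : func L 2).
Hypothesis valid : forall p, (forall e : nat -> S1, sat e p) -> forall e : nat -> S2, sat e p.

Local Notation v := (Var L).
Local Notation "t + u" := (tadd plus t u).

Lemma dense_transfer : (forall x y : S1, lt x y -> exists z, lt x z /\ lt z y) ->
  forall x y : S2, lt x y -> exists z, lt x z /\ lt z y.
Proof.
move=> h x y xy; pose andF p q : formula L := Imp (Imp p (Imp q (Bot L))) (Bot L).
have sat_and (T : structure L) (e : nat -> T) p q : sat e (andF p q) <-> sat e p /\ sat e q.
  rewrite /=; split=> [H|[hp hq] H]; last exact: H.
  by split; apply: contrapT => n; apply: H.
have V := @valid (Imp (Lt (v 0) (v 1)) (Ex (andF (Lt (v 1) (v 0)) (Lt (v 0) (v 2))))).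
have := V _ (fun k => if k is 0 then x else y); rewrite satE sat_ex.
case=> // [e|z /sat_and hz].
  rewrite satE => /h[z hz].
  by apply/sat_ex; exists z; apply/sat_and.
by exists z.
Qed.

Lemma unbounded_transfer :
  (forall x : S1, exists y, lt y x) /\ (forall x : S1, exists y, lt x y) ->
  (forall x : S2, exists y, lt y x) /\ (forall x : S2, exists y, lt x y).
Proof.
move=> [hl hr]; split=> x.
  have V := @valid (Ex (Lt (v 0) (v 1))).
  by have := V _ (fun _ => x); rewrite sat_ex; apply=> e; rewrite sat_ex; apply: hl.
have V := @valid (Ex (Lt (v 1) (v 0))).
by have := V _ (fun _ => x); rewrite sat_ex; apply=> e; rewrite sat_ex; apply: hr.
Qed.

(** Only the operation is a symbol of the language. The neutral element is recovered as an
    idempotent and the inverses by choice. *)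
Lemma ordered_group_transfer (zero1 : S1) (opp1 : S1 -> S1) (a : S2) :
  ordered_group (@lt L S1) (binop plus) zero1 opp1 ->
  exists (zero2 : S2) (opp2 : S2 -> S2),
    ordered_group (@lt L S2) (binop plus) zero2 opp2.
Proof.
move=> hg; pose env (x y z : S2) k := match k with 0 => x | 1 => y | _ => z end.
have idem x : binop plus x x = x -> x = zero1.
  by rewrite -{3}(addr0 hg x) => /(congr1 (binop plus (opp1 x))); rewrite !(addKr hg).
have [zero2 z2] : exists z : S2, binop plus z z = z.
  have V := @valid (Ex (Eq (v 0 + v 0) (v 0))).
  have := V _ (fun _ => a); rewrite sat_ex; case=> [e|z]; last by rewrite !satE eval_tadd; exists z.
  by apply/sat_ex; exists zero1; rewrite !satE eval_tadd; apply: og_add0 hg _.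
have add02 x : binop plus zero2 x = x.
  have V := @valid (Imp (Eq (v 0 + v 0) (v 0)) (Eq (v 0 + v 1) (v 1))).
  have := V _ (env zero2 x x); rewrite !satE !eval_tadd; apply=> // e; rewrite !satE !eval_tadd /=.
  by move/idem ->; apply: og_add0 hg _.
have /choice[opp2 hopp] : forall x, exists y, binop plus y x = zero2.
  move=> x.
  have V := @valid (Imp (Eq (v 0 + v 0) (v 0)) (Ex (Eq (v 0 + v 2) (v 1)))).
  have := V _ (env zero2 x x); rewrite satE sat_ex satE eval_tadd.
  case=> [e|//|y]; last by rewrite satE eval_tadd; exists y.
  rewrite satE sat_ex satE eval_tadd => /idem e0; exists (opp1 (e 1)).
  rewrite satE eval_tadd; move: e0 => /= e0; rewrite e0; apply: og_addN hg _.
exists zero2, opp2; split=> //.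
- move=> x; have V := @valid (Imp (Lt (v 0) (v 0)) (Bot L)).
  by have := V _ (env x x x); apply=> e; apply: og_irrefl hg _.
- move=> x y z; have V := @valid (Imp (Lt (v 0) (v 1)) (Imp (Lt (v 1) (v 2)) (Lt (v 0) (v 2)))).
  by have := V _ (env x y z); apply=> e; apply: og_trans hg _ _ _.
- move=> x y; have V := @valid (Imp (Imp (Lt (v 0) (v 1)) (Bot L))
    (Imp (Imp (Eq (v 0) (v 1)) (Bot L)) (Lt (v 1) (v 0)))).
  have := V _ (env x y x); rewrite !satE /= => h.
  case: (pselect (lt x y)); first by left.
  case: (pselect (x = y)); first by right; left.
  move=> n1 n2; right; right; apply: h => // e n3 n4.
  by have [|[]] := og_total hg (e 0) (e 1).
- move=> x y z; have V := @valid (Eq (v 0 + (v 1 + v 2)) (v 0 + v 1 + v 2)).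
  have := V _ (env x y z); rewrite !satE !eval_tadd; apply=> e; rewrite !satE !eval_tadd.
  exact: og_addA hg _ _ _.
- move=> x y z; have V := @valid (Imp (Lt (v 1) (v 2)) (Lt (v 0 + v 1) (v 0 + v 2))).
  have := V _ (env x y z); rewrite !satE !eval_tadd; apply=> e; rewrite !satE !eval_tadd.
  exact: og_lt_addl hg _ _ _.
- move=> x y z; have V := @valid (Imp (Lt (v 1) (v 2)) (Lt (v 1 + v 0) (v 2 + v 0))).
  have := V _ (env x y z); rewrite !satE !eval_tadd; apply=> e; rewrite !satE !eval_tadd.
  exact: og_lt_addr hg _ _ _.
Qed.

End GroupTransfer.

(** * Definable sets of a trace *)

Section Trace.
Variables (L : language) (S N : structure L) (j : S -> N).
Hypothesis hj : elementary j.
Hypothesis hdense : dense_image j.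
Hypothesis hmin : o_minimal N.
Variables (plus : func L 2) (zero : N) (opp : N -> N).
Hypothesis hg : ordered_group (@lt L N) (binop plus) zero opp.
Variable a0 : S.
Hypothesis nomin : forall x : N, exists y, lt y x.
Hypothesis nomax : forall x : N, exists y, lt x y.
Implicit Types (A X : N -> Prop) (P Q : (nat -> N) -> Prop) (c : seq N) (b z : N).
Local Notation "x < y" := (lt x y).
Local Notation all := (fun _ : N => True).

Local Ltac order := order_with hg.

Let inh : exists a : N, True. Proof. by exists zero. Qed.

Definition over c (b : N) := (exists a, j a = b) \/ List.In b c.

Let over_inh c : exists b, over c b. Proof. by exists (j a0); left; exists a0. Qed.

Fixpoint indep c := if c is c0 :: c1 then ~ dcl (over c1) c0 /\ indep c1 else True.

Lemma indep_reduce c : exists c', indep c' /\ forall b, List.In b c -> dcl (over c') b.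
Proof.
elim: c => [|c0 c [c' [ic hc]]]; first by exists nil.
case: (pselect (dcl (over c') c0)) => h0; first by exists c'; split=> // b [<-|/hc].
exists (c0 :: c'); split=> // b [<-|/hc]; first by apply: dcl_sub; right; left.
by apply: dcl_mono => b' [|]; [left|right; right].
Qed.

Lemma dfn_indep P : dfn all P -> exists c, indep c /\ dfn (over c) P.
Proof.
move/dfn_finite => [l [_ hP]]; have [c [ic hc]] := indep_reduce l.
by exists c; split=> //; apply: dfn_dcl => //; apply: dfn_mono hP => b /hc.
Qed.

Let dense (x y : N) : x < y -> exists z, x < z /\ z < y.
Proof. by move/hdense => [a ha]; exists (j a). Qed.

Lemma near_left b X : dfn1 all X -> (forall p, p < b -> exists a, p < j a /\ j a < b /\ X (j a)) ->
  exists p, p < b /\ forall z, p < z -> z < b -> X z.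
Proof.
move=> hX h; have [p pb] := nomin b.
have [p' [p'b [_ hp]]] := tame_left hg (omin_tame hg hmin hX) pb.
have [a [pa [ab Xa]]] := h p' p'b.
by exists p'; split=> // z pz zb; apply: (hp (j a)).
Qed.

Lemma near_right b X : dfn1 all X -> (forall q, b < q -> exists a, b < j a /\ j a < q /\ X (j a)) ->
  exists q, b < q /\ forall z, b < z -> z < q -> X z.
Proof.
move=> hX h; have [q bq] := nomax b.
have [q' [bq' [_ hq]]] := tame_right hg (omin_tame hg hmin hX) bq.
have [a [ba [aq Xa]]] := h q' bq'.
by exists q'; split=> // z bz zq; apply: (hq (j a)).
Qed.

(* Otherwise [b] would be definable, as the only point of [X] in some interval that is
   not interior to [X]. *)
Lemma generic_interval A b X : (forall a, A (j a)) -> ~ dcl A b -> dfn1 A X -> X b ->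
  exists p q, j p < b /\ b < j q /\ forall z, j p < z -> z < j q -> X z.
Proof.
move=> hA nb hX Xb; have [l lb] := nomin b; have [r br] := nomax b.
have inhA : exists a, A a by exists (j a0).
have tX : tame all X by apply: (omin_tame hg hmin); apply: dfn_mono hX.
have [u [ub [_ hu]]] := tame_left hg tX lb; have [v [bv [_ hv]]] := tame_right hg tX br.
have [p [up pb]] := hdense ub; have [q [bq qv]] := hdense bv.
exists p, q; split=> //; split=> // z pz zq; apply: contrapT => nz; apply: nb.
pose I z := exists s t, s < z /\ z < t /\ forall w, s < w -> w < t -> X w.
have : dfn1 A (fun z => j p < z /\ z < j q /\ X z /\ ~ I z) by rewrite /I; defin.
apply: dfn_ext => x; split=> [[px [xq [Xx nI]]]|->].
  have [xb|[//|bx]] := og_total hg (x 0) b; case: nI.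
    by exists (j p), b; split=> //; split=> // w pw wb; apply: (hu (x 0)) => //; order.
  by exists b, (j q); split=> //; split=> // w pw wb; apply: (hv (x 0)) => //; order.
split=> //; split=> //; split=> // -[s [t [sb [bt hI]]]]; apply: nz.
have [zb|[->//|bz]] := og_total hg z b.
  have [m [m1 [m2 m3]]] := max2 hg s (j p).
  have mb : m < b by case: m1 => ->.
  have [w [mw wb]] := dense mb.
  by apply: (hu w) => //; [order|order|apply: hI; order].
have [m [m1 [m2 m3]]] := min2 hg t (j q).
have mb : b < m by case: m1 => ->.
have [w [mw wb]] := dense mb.
by apply: (hv w) => //; [order|order|apply: hI; order].
Qed.

(* For [c0] outside the definable closure of the other parameters, a condition on [c0]
   holds iff it holds on an interval with endpoints [p], [q] in [S]. Shrinking the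
   interval preserves this, so the quantifiers over [p] and [q] in [S] can be replaced
   by quantifiers over all points of [N] that are close enough to [c0]. *)
Lemma trace_ex_indep c P : indep c -> dfn (over c) P ->
  exists Q, dfn all Q /\
    forall x : nat -> S, (exists a, P (push (j a) (fun k => j (x k)))) <-> Q (fun k => j (x k)).
Proof.
elim: c P => [|c0 c IH] P.
  move=> _ hP; have hP' : dfn (fun b => exists a, j a = b) P.
    by apply: dfn_mono hP => b [|[]].
  exists (fun y => exists z, P (push z y)); split=> [|x].
    apply: (@dfn_ex _ _ _ (fun z y => P (push z y))).
    by apply: dfn_ext (dfn_mono _ hP') => // y; rewrite push_eta.
  split=> [[a Pa]|[z Pz]]; first by exists (j a).
  have [|b [[a <-] Pa]] := elementary_tv hj hP' _ (ex_intro _ z Pz); last by exists a.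
  by move=> k; exists (x k).
case=> nc0 ic hP.
have [P1 [hP1 PP1]] : exists Q, dfn (over c) Q /\ forall x, P x <-> Q (push c0 x).
  apply: dfn_add => //; apply: dfn_mono hP => b [|[->|]]; [left|right|left] => //; first by left.
  by right.
have cj a : over c (j a) by left; exists a.
(* [w 0] is the witness, [w 1] and [w 2] are the ends of the interval. Quantifying over [z] in place
   of [c0] leaves a condition with one parameter fewer. *)
pose P2 (w : nat -> N) := forall z, w 1 < z -> z < w 2 ->
  P1 (push z (push (w 0) (fun k => w k.+3))).
have hP2 : dfn (over c) P2.
  rewrite /P2; apply: (@dfn_all _ _ _ (fun z w => w 1 < z -> z < w 2 ->
    P1 (push z (push (w 0) (fun k => w k.+3))))).
  have inhc := over_inh c; apply: dfn_imp; first by defin.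
  apply: dfn_imp; first by defin.
  apply: dfn_ext (dfn_ren (fun k => match k with 0 => 0 | 1 => 1 | k'.+2 => k'.+4 end) hP1) => w.
  by rewrite (_ : push _ _ = (fun k => w (match k with 0 => 0 | 1 => 1 | k'.+2 => k'.+4 end)));
    last by apply: funext => -[|[|k]].
have [Q1 [hQ1 PQ1]] := IH P2 ic hP2.
pose E (x : nat -> S) p q := Q1 (push (j p) (push (j q) (fun k => j (x k)))).
have EE x p q : E x p q <-> exists a, forall z, j p < z -> z < j q ->
    P1 (push z (push (j a) (fun k => j (x k)))).
  have := PQ1 (push p (push q x)).
  rewrite (_ : (fun k => j (push p (push q x) k)) = push (j p) (push (j q) (fun k => j (x k))));
    last by apply: funext => -[|[|k]].
  by rewrite /E => <-.
have step (x : nat -> S) : (exists a, P (push (j a) (fun k => j (x k)))) <->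
    exists p q, j p < c0 /\ c0 < j q /\ E x p q.
  split=> [[a /PP1 Pa]|[p [q [pc [cq /EE[a Ha]]]]]]; last by exists a; apply/PP1; apply: Ha.
  have hX : dfn1 (over c) (fun z => P1 (push z (push (j a) (fun k => j (x k))))).
    by apply: dfn_inst => // -[|k]; apply: cj.
  have [p [q [pc [cq H]]]] := generic_interval cj nc0 hX Pa.
  by exists p, q; do 2!split=> //; apply/EE; exists a.
have mono (x : nat -> S) p q p' q' : ~ j p' < j p -> ~ j q < j q' ->
    j p' < c0 -> c0 < j q' -> E x p q -> E x p' q'.
  move=> hp hq pc cq.
  by move=> /EE[a Ha]; apply/EE; exists a => z pz zq; apply: Ha; order.
pose R q y := exists p0, p0 < c0 /\ forall p, p0 < p -> p < c0 -> Q1 (push p (push q y)).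
have hR : dfn all (fun y => R (y 0) (fun k => y k.+1)).
  rewrite /R; apply: (@dfn_ex _ _ _ (fun p0 y => p0 < c0 /\ forall p, p0 < p -> p < c0 ->
     Q1 (push p (push (y 0) (fun k => y k.+1))))).
  apply: dfn_and; first by defin.
  apply: (@dfn_all _ _ _ (fun p y => y 0 < p -> p < c0 ->
     Q1 (push p (push (y 1) (fun k => y k.+2))))).
  apply: dfn_imp; first by defin.
  apply: dfn_imp; first by defin.
  apply: dfn_ext (dfn_ren (fun k => if k is k'.+1 then k'.+2 else 0) hQ1) => w.
  by rewrite (_ : push _ _ = (fun k => w (if k is k'.+1 then k'.+2 else 0)));
    last by apply: funext => -[|[|k]].
exists (fun y => exists q0, c0 < q0 /\ forall q, c0 < q -> q < q0 -> R q y); split.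
  apply: (@dfn_ex _ _ _ (fun q0 y => c0 < q0 /\ forall q, c0 < q -> q < q0 -> R q y)).
  apply: dfn_and; first by defin.
  apply: (@dfn_all _ _ _ (fun q y => c0 < q -> q < y 0 -> R q (fun k => y k.+1))).
  apply: dfn_imp; first by defin.
  apply: dfn_imp; first by defin.
  exact: (dfn_ren (fun k => if k is k'.+1 then k'.+2 else 0) hR).
move=> x; rewrite step; split=> [[p [q [pc [cq Exy]]]]|[q0 [cq0 H]]]; last first.
  have [q [cq qq0]] := hdense cq0; have [p0 [p0c Hp]] := H _ cq qq0.
  have [p [pp0 pc]] := hdense p0c.
  by exists p, q; do 2!split=> //; apply: Hp.
apply: near_right => [|q' cq'].
  have := @dfn_inst _ _ _ _ (fun k => j (x k)) hR (fun _ => I).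
  exact.
have [m [m1 [m2 m3]]] := min2 hg q' (j q).
have cm : c0 < m by case: m1 => ->.
have [s [cs sm]] := hdense cm; exists s; split=> //; split; first by order.
apply: near_left => [|p' pc'].
  have := @dfn_inst _ _ _ _ (push (j s) (fun k => j (x k))) hQ1 (fun _ => I).
  exact.
have [n [n1 [n2 n3]]] := max2 hg p' (j p).
have nc : n < c0 by case: n1 => ->.
have [r [nr rc]] := hdense nc; exists r; split; first by order.
split=> //; apply: (mono _ _ _ _ _ _ _ _ _ Exy) => //; order.
Qed.

Lemma trace_ex P : dfn all P -> exists Q, dfn all Q /\
  forall x : nat -> S, (exists a, P (push (j a) (fun k => j (x k)))) <-> Q (fun k => j (x k)).
Proof. by move/dfn_indep => [c [ic hP]]; apply: trace_ex_indep hP. Qed.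

Lemma trace_term (t : term (trace_language N)) : exists u : (nat -> N) -> N, dfun all u /\
  forall x : nat -> S, j (@eval _ (trace_expansion j) x t) = u (fun k => j (x k)).
Proof.
elim: t => [k|n f ts IH].
  by exists (fun y => y k); split=> //; apply: dfun_var.
have /choice[u hu] := IH; exists (fun y => @fint L N n f (fun i => u i y)); split.
  by apply: dfun_app => // i; case: (hu i).
move=> x; rewrite /= (elementary_fint hj); congr fint; apply: funext => i.
by case: (hu i) => _; apply.
Qed.

Lemma trace_sat (p : formula (trace_language N)) : exists P, dfn all P /\
  forall x : nat -> S, @sat _ (trace_expansion j) x p <-> P (fun k => j (x k)).
Proof.
elim: p => [t u|t u|n r ts||p [P [hP PP]] q [Q [hQ QQ]]|p [P [hP PP]]].
- have [t' [ht tt]] := trace_term t; have [u' [hu uu]] := trace_term u.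
  exists (fun y => t' y = u' y); split=> [|x]; first exact: dfn_eq.
  by rewrite -tt -uu /=; apply: elementary_eq hj _ _.
- have [t' [ht tt]] := trace_term t; have [u' [hu uu]] := trace_term u.
  exists (fun y => t' y < u' y); split=> [|x]; first exact: dfn_lt.
  by rewrite -tt -uu /=; apply: elementary_lt hj _ _.
- have /choice[u hu] := fun i => trace_term (ts i).
  have uu x : (fun i => u i (fun k => j (x k))) =
      fun i => j (@eval _ (trace_expansion j) x (ts i)).
    by apply: funext => i; case: (hu i) => _ ->.
  case: r => [r|[D hD]].
    exists (fun y => @rint L N n r (fun i => u i y)); split=> [|x].
      by apply: dfn_rel => // i; case: (hu i).
    by rewrite uu /=; apply: elementary_rint.
  exists (fun y => D (fun i => u i y)); split=> [|x]; last by rewrite uu.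
  by apply: dfn_reln => [|i]; [apply/definable_dfn|case: (hu i)].
- by exists (fun _ => False); split=> //; apply: dfn_bot.
- exists (fun y => P y -> Q y); split=> [|x]; first exact: dfn_imp.
  by rewrite -PP -QQ.
- have [Q [hQ QQ]] := trace_ex (dfn_not hP).
  exists (fun y => ~ Q y); split=> [|x]; first exact: dfn_not.
  have E a : (fun k => j (@push _ (trace_expansion j) a x k)) = push (j a) (fun k => j (x k)).
    by apply: funext => -[].
  rewrite -QQ /= -forallNE; split=> H a; last by apply/PP; rewrite E; apply: contrapT; apply: H.
  by rewrite -E => n; apply/n/PP.
Qed.

Lemma trace_definable1 (X : S -> Prop) : @definable1 _ (trace_expansion j) X ->
  exists Y, dfn1 all Y /\ forall a, X a <-> Y (j a).
Proof.
move=> [p [e h]]; have [P [hP PP]] := trace_sat p.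
exists (fun z => P (push z (fun k => j (e k)))); split; first exact: dfn_inst.
move=> a; rewrite (h (fun _ => a)) PP.
suff -> : (fun k => j (@glue _ (trace_expansion j) 1 (fun _ => a) e k)) =
          push (j a) (fun k => j (e k)) by [].
apply: funext => -[|k]; rewrite /glue; first by rewrite insubT.
by rewrite insubF // subn1.
Qed.

End Trace.

(* The group operation of [N] in [o_minimal_trace] need not be the given one of [M];
   the two are compared on bounded intervals. *)
Section TwoGroups.
Variables (L : language) (M : structure L) (p1 p2 : func L 2).
Variables (zero1 zero2 : M) (opp1 opp2 : M -> M).
Hypothesis hg1 : ordered_group (@lt L M) (binop p1) zero1 opp1.
Hypothesis hg2 : ordered_group (@lt L M) (binop p2) zero2 opp2.
Hypothesis hmin : o_minimal M.
Hypothesis dense : forall x y : M, lt x y -> exists z, lt x z /\ lt z y.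
Local Notation "x < y" := (lt x y).
Local Notation "x +1 y" := (binop p1 x y) (at level 50).
Local Notation "x +2 y" := (binop p2 x y) (at level 50).

Local Ltac order := order_with hg1.

Lemma uniform_shift_local h s : zero1 < h -> exists u v e, u < s /\ s < v /\ zero2 < e /\
  forall x, u < x -> x < v -> x +2 e < x +1 h.
Proof.
move=> h0; have [z [sz zh]] := dense (iffRL (lt_addr_pos hg1 s h) h0).
have [v [sv vz]] := dense sz.
(* The point [z] separates the two translates: [x] above [z - h] gives [z < x +1 h], and [x] below
   [v] gives [x +2 e < z] for [e] the distance from [v] to [z] in the second group. *)
exists (z +1 opp1 h), v, (opp2 v +2 z); split.
  by apply/(ltD2r hg1 h); rewrite (addrNK hg1).
split=> //; split; first by apply/(lt_addr_pos hg2 v); rewrite (addNKr hg2).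
move=> x /(ltD2r hg1 h); rewrite (addrNK hg1) => zx /(ltD2r hg2 (opp2 v +2 z)).
by rewrite (addNKr hg2) => xz; order.
Qed.

(** Definable compactness of the interval: the points up to which one [e] works have a supremum, and
    the local bound there carries it further. The start [a'] lies below [a], where the condition is
    vacuous. *)
Lemma uniform_shift h a b : zero1 < h -> exists e, zero2 < e /\
  forall x, ~ x < a -> ~ b < x -> x +2 e < x +1 h.
Proof.
move=> h0; have [nomin nomax] := unbounded hg1 h0.
have inh : exists a : M, True by exists a.
pose K y := exists e, zero2 < e /\ forall x, ~ x < a -> ~ y < x -> x +2 e < x +1 h.
apply: contrapT => nKb; have hK : dfn1 (fun _ => True) K by rewrite /K; defin.
have low x y : x < y -> K y -> K x.
  by move=> xy [e [e0 he]]; exists e; split=> // z az zx; apply: he => //; order.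
have [a' a'a] := nomin a; have Ka' : K a'.
  by have [e e0] := nomax zero2; exists e; split=> // x xa xa'; exfalso; order.
have [s [_ [_ [below above]]]] := definable_sup hg1 hmin hK low Ka' nKb.
have [u [v [e [us [sv [e0 he]]]]]] := uniform_shift_local s h0.
have [y [uy ys]] := dense us; have [e' [e'0 he']] := below y ys.
have [z [sz zv]] := dense sv; apply: (above z sz).
have [m [m1 [m2 m3]]] := min2 hg1 e e'; exists m; split; first by case: m1 => ->.
move=> x ax xz.
have h1 : ~ x +2 e < x +2 m by move/(ltD2l hg2).
have h2 : ~ x +2 e' < x +2 m by move/(ltD2l hg2).
case: (pselect (y < x)) => yx; last by have := he' x ax yx; order.
have ux : u < x by order.
have xv : x < v by order.
by have := he x ux xv; order.
Qed.

End TwoGroups.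

Lemma trace_not_valuational (L : language) (M : structure L)
    (plus : func L 2) (zero : M) (opp : M -> M)
    (hgroup : ordered_group (@lt L M) (binop plus) zero opp)
    (hmin : o_minimal M) (I : Type) (C : I -> M -> Prop) :
  o_minimal_trace (expansion_by_cuts C) ->
  ~ @valuational _ (expansion_by_cuts C) (binop plus) zero opp.
Proof.
move=> [F0 [R0 [N [j [[f [zN [oN hgN]]] [hmN [_ [hd [hj hdef]]]]]]]]].
move=> [H [dH [cvx [[H0 [HD HN]] [[h0 [Hh0 nz]] [w0 nHw0]]]]]].
have {}HD x y : H x -> H y -> H (binop plus x y) by exact: HD.
have valid p : (forall e : nat -> N, sat e p) -> forall e : nat -> reduct (expansion_by_cuts C) F0 R0, sat e p.
  by move=> h; apply: (iffRL (elementary_valid hj p (zero : reduct (expansion_by_cuts C) F0 R0)) h).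
have [z2 [o2 hg2]] := ordered_group_transfer valid (zero : reduct (expansion_by_cuts C) F0 R0) hgN.
have {}hg2 : ordered_group (@lt L M) (@binop L M (sval f)) z2 o2 by exact: hg2.
have densem (x y : M) : lt x y -> exists z, lt x z /\ lt z y.
  move/(elementary_lt hj)/hd => [z [xz zy]].
  by exists z; split; apply/(elementary_lt hj).
have [h [Hh hpos]] : exists h, H h /\ lt zero h.
  have [h0z|[//|zh0]] := og_total hgroup h0 zero; last by exists h0.
  exists (opp h0); split; first exact: HN.
  by have /(og_lt_addl hgroup (opp h0)) := h0z; rewrite (og_addN hgroup) (addr0 hgroup).
have [w [nHw wpos]] : exists w, ~ H w /\ lt zero w.
  have [w0z|[E|zw0]] := og_total hgroup w0 zero; last by exists w0.
    exists (opp w0); split.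
      move/HN => Hw0; apply: nHw0.
      by rewrite -(addKr hgroup (opp w0) w0) (og_addN hgroup) (addr0 hgroup).
    by have /(og_lt_addl hgroup (opp w0)) := w0z; rewrite (og_addN hgroup) (addr0 hgroup).
  by case: nHw0; rewrite E.
have Hw x : H x -> lt x w.
  move=> Hx; have [//|[E|wx]] := og_total hgroup x w; first by case: nHw; rewrite -E.
  by case: nHw; apply: cvx H0 Hx wpos wx.
have Hlt x : H x -> lt (j x) (j (binop plus x h)).
  by move=> Hx; apply/(elementary_lt hj)/(lt_addr_pos hgroup).
(* The subgroup is closed under adding [h] with the operation of M, while the supremum in N can be
   approached only with the operation of N; [e] is a step of the latter smaller than [h] throughout
   [H]. *)
have [e [epos he]] := uniform_shift hgroup hg2 hmin densem zero w hpos.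
have jadd x y : j (@binop L M (sval f) x y) = binop f (j x) (j y).
  exact: (elementary_binop hj f).
have jepos : lt zN (j e).
  apply/(lt_addr_pos hgN (j e)); rewrite -jadd; apply/(elementary_lt hj).
  by apply/(lt_addr_pos hg2).
have [nomin nomax] := unbounded hgN jepos.
have [Y [dY HY]] : exists Y, dfn1 (fun _ : N => True) Y /\ forall a, H a <-> Y (j a).
  apply: (trace_definable1 hj hd hmN hgN zero nomin nomax).
  exact/(hdef 1%N (fun x => H (x ord0))).
pose K y := exists x, H x /\ lt y (j x).
have low x y : lt x y -> K y -> K x.
  by move=> xy [a [Ha ya]]; exists a; split=> //; apply: (og_trans hgN xy ya).
have KH x : H x -> K (j x).
  by move=> Hx; exists (binop plus x h); split; [apply: HD|apply: Hlt].
have nKw : ~ K (j w).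
  move=> [x [Hx /(elementary_lt hj) wx]].
  by apply: (og_irrefl hgroup (x := x)); apply: (og_trans hgroup (Hw x Hx) wx).
(* The lower set [K] need not be known definable; a gap is excluded by comparing it with the
   definable set [Y], which has the same points in the dense image of M near the gap. *)
have [[d [_ [_ [below above]]]]|gap] := lower_set_sup hgN low (KH _ H0) nKw; last first.
  have [nY|nY] := tame_near hgN (omin_tame hgN hmN dY) gap.
    have [p [q [Kp [Kq hpq]]]] := nY; have [_ [_ [_ [_ Knomin]]]] := gap.
    have [q' [Kq' q'q]] := Knomin q Kq; have [a [q'a aq]] := hd _ _ q'q.
    have pa := og_trans hgN (cut_lt hgN gap Kp Kq') q'a.
    by apply: Kq'; apply: low q'a _; apply: KH; apply/HY; apply: hpq.
  have [p [q [[x [Hx px]] [Kq hpq]]]] := nY.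
  by apply: (hpq (j x)) => //; [exact: (cut_lt hgN gap (KH x Hx) Kq)|apply/HY].
have Hd x : H x -> ~ lt d (j x) by move=> Hx /above; apply; apply: KH.
have zd : lt (j zero) d by apply: (lt_le_trans hgN (Hlt _ H0) (Hd _ (HD _ _ H0 Hh))).
(* A point [x] of the subgroup above [d - e] has its translate by [e] beyond [d], although the
   larger point [x + h] still belongs to the subgroup. *)
pose y := binop f d (oN (j e)).
have yd : lt y d by apply: (lt_opp_pos hgN _ jepos).
have [m [m1 [m2 m3]]] := max2 hgN y (j zero).
have md : lt m d by case: m1 => ->.
have [x [mx xd]] := hd _ _ md.
have zx : lt zero x by apply/(elementary_lt hj); apply: (le_lt_trans hgN m3 mx).
have [x1 [Hx1 /(elementary_lt hj) xx1]] := below _ xd.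
have Hx : H x by apply: cvx H0 Hx1 zx xx1.
have nxz : ~ lt x zero by move=> xz; apply: (og_irrefl hgroup (x := x)); apply: (og_trans hgroup xz zx).
have nwx : ~ lt w x.
  move=> wx; apply: (og_irrefl hgroup (x := x)).
  exact: (og_trans hgroup (Hw x Hx) wx).
have /(elementary_lt hj) := he x nxz nwx; rewrite jadd => xe.
apply: (Hd _ (HD _ _ Hx Hh)); apply: (og_trans hgN _ xe).
have yx : lt y (j x) by apply: (le_lt_trans hgN m2 mx).
by have /(og_lt_addr hgN (j e)) := yx; rewrite /y (addrNK hgN).
Qed.

(** * Realizing cuts in an ultrapower *)

Section Ultrapower.
Variables (L : language) (S : structure L) (T : Type) (U : set_system T).
Hypothesis UF : UltraFilter U.
Implicit Types (f g : T -> S).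

Definition ueq f g := U (fun t => f t = g t).

Lemma ultra_and (A B : T -> Prop) : U A -> U B -> U (fun t => A t /\ B t).
Proof. exact: filterI. Qed.

Lemma ultra_mono (A B : T -> Prop) : (forall t, A t -> B t) -> U A -> U B.
Proof. exact: filterS. Qed.

Lemma ultra_imp (A B : T -> Prop) : U (fun t => A t -> B t) <-> (U A -> U B).
Proof.
split=> [h hA|h]; first by apply: ultra_mono (ultra_and h hA) => t [hab]; apply: hab.
have [/h|] := in_ultra_setVsetC A UF; first by apply: ultra_mono.
by apply: ultra_mono => t nA /nA.
Qed.

Lemma ultra_false : ~ U (fun _ => False).
Proof. exact: filter_not_empty. Qed.

Lemma ueq_sym f g : ueq f g -> ueq g f.
Proof. exact: ultra_mono. Qed.

Lemma ueq_trans f g h : ueq f g -> ueq g h -> ueq f h.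
Proof. by move=> fg gh; apply: ultra_mono (ultra_and fg gh) => t [->]. Qed.

Lemma ueq_ex f : exists g, ueq f g.
Proof. by exists f; apply: filterE. Qed.

(** A representative chosen from the class [ueq f] alone, hence the same for equivalent functions.
    The ultrapower consists of representatives because [Eq] is interpreted by equality itself. *)
Definition canon f : T -> S := sval (cid (ueq_ex f)).

Lemma ueq_canon f : ueq f (canon f).
Proof. exact: (svalP (cid (ueq_ex f))). Qed.

Lemma canon_eq f g : ueq f g -> canon f = canon g.
Proof.
move=> fg; rewrite /canon; move: (ueq_ex f) (ueq_ex g).
rewrite (_ : ueq f = ueq g) => [hf hg|]; first by rewrite (Prop_irrelevance hf hg).
by apply: funext => h; apply: propext; split; apply: ueq_trans => //; apply: ueq_sym.
Qed.

Lemma canon_canon f : canon (canon f) = canon f.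
Proof. by apply/canon_eq/ueq_sym/ueq_canon. Qed.

Definition ucar := {f : T -> S | canon f = f}.

Definition uclass f : ucar := exist _ (canon f) (canon_canon f).

Lemma ueq_class f : ueq (sval (uclass f)) f.
Proof. exact/ueq_sym/ueq_canon. Qed.

Lemma ucar_eq (x y : ucar) : x = y <-> ueq (sval x) (sval y).
Proof.
split=> [->|]; first exact: filterE.
case: x y => f hf [g hg] /= /canon_eq; rewrite hf hg => fg; subst g.
by congr exist; apply: Prop_irrelevance.
Qed.

Definition ultrapower : structure L :=
  @Structure L ucar (fun x y => U (fun t => lt (sval x t) (sval y t)))
    (fun n F x => uclass (fun t => fint F (fun i => sval (x i) t)))
    (fun n R x => U (fun t => rint R (fun i => sval (x i) t))).

Lemma ultra_forall n (A : 'I_n -> T -> Prop) :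
  (forall i, U (A i)) -> U (fun t => forall i, A i t).
Proof. by move=> h; apply: (@filter_forall T 'I_n A U). Qed.

Lemma ultrapower_eval (e : nat -> ultrapower) t :
  ueq (sval (eval e t)) (fun k => eval (fun i => sval (e i) k) t).
Proof.
elim: t => [i|n F ts IH] /=; first exact: filterE.
apply: ueq_trans (ueq_class _) _.
by apply: ultra_mono (ultra_forall IH) => k /funext ->.
Qed.

Lemma los (p : formula L) (e : nat -> ultrapower) :
  sat e p <-> U (fun k => sat (fun i => sval (e i) k) p).
Proof.
elim: p e => [t u|t u|n R ts||p IHp q IHq|p IH] e /=.
- have ht := ultrapower_eval e t; have hu := ultrapower_eval e u.
  rewrite ucar_eq; split=> h.
    by apply: ueq_trans (ueq_sym ht) (ueq_trans h hu).
  by apply: ueq_trans ht (ueq_trans h (ueq_sym hu)).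
- have h := ultra_and (ultrapower_eval e t) (ultrapower_eval e u).
  by split=> h'; apply: ultra_mono (ultra_and h h') => k [[-> ->]].
- have h := ultra_forall (fun i => ultrapower_eval e (ts i)).
  by split=> h'; apply: ultra_mono (ultra_and h h') => k [/funext->].
- by split=> // /ultra_false.
- by rewrite IHp IHq ultra_imp.
- split=> [H|H a]; last first.
    apply/IH; apply: ultra_mono H => k /(_ (sval a k)).
    by congr sat; apply: funext => -[].
  (* At each index [g] takes a counterexample if there is one. *)
  have /choice[g hg] : forall k, exists a, sat (push a (fun i => sval (e i) k)) p ->
      forall a, sat (push a (fun i => sval (e i) k)) p.
    move=> k; have [[a ha]|n] := pselect (exists a, ~ sat (push a (fun i => sval (e i) k)) p).
      by exists a.
    by exists (sval (e 0) k) => _ a; apply: contrapT => na; apply: n; exists a.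
  have /IH h := H (uclass g).
  apply: ultra_mono (ultra_and (ueq_class g) h) => k [gk hk]; apply: hg.
  by move: hk; congr sat; apply: funext => -[].
Qed.

Definition diag (a : S) : ultrapower := uclass (fun _ => a).

Lemma diag_elementary : elementary diag.
Proof.
move=> p e; rewrite los.
(* The class of a constant function agrees with it only almost everywhere, so the variables must be
   reduced to finitely many. *)
have [K hK] := sat_finite S p.
have h : U (fun k => forall i : 'I_K, sval (diag (e i)) k = e i).
  by apply: ultra_forall => i; apply: ueq_class.
have E : U (fun k => sat e p <-> sat (fun i => sval (diag (e i)) k) p).
  by apply: ultra_mono h => k hk; apply: hK => i iK; rewrite (hk (Ordinal iK)).
split=> [hp|h']; first by apply: ultra_mono E => k /iffLR; apply.
apply: contrapT => n; apply: ultra_false.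
by apply: ultra_mono (ultra_and E h') => k [/iffRL He /He].
Qed.

End Ultrapower.

(* In an ultrapower indexed by the finite subsets of [S], with an ultrafilter that
   contains all cones, every cut of [S] is realized. *)
Lemma cuts_realized (L : language) (S : structure L)
    (tr : forall x y z : S, lt x y -> lt y z -> lt x z)
    (tot : forall x y : S, lt x y \/ x = y \/ lt y x) :
  exists (S' : structure L) (j : S -> S'), elementary j /\
    forall C : S -> Prop, is_cut (@lt L S) C ->
      (exists x, C x) ->
      exists a, (forall x, C x -> lt (j x) a) /\ (forall x, ~ C x -> lt a (j x)).
Proof.
pose cone (l : seq S) : set (seq S) := fun s => forall x, List.In x l -> List.In x s.
pose F : set_system (seq S) := fun A => exists l, forall s, cone l s -> A s.
have PF : ProperFilter F.
  split; first by case=> l /(_ l); apply.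
  split; first by exists nil.
    move=> A B [l hl] [m hm]; exists (l ++ m)%list => s hs; split.
      by apply: hl => x hx; apply: hs; apply/List.in_or_app; left.
    by apply: hm => x hx; apply: hs; apply/List.in_or_app; right.
  by move=> A B AB [l hl]; exists l => s /hl/AB.
have [U [UF FU]] := ultraFilterLemma PF.
exists (ultrapower S UF), (diag UF); split; first exact: diag_elementary.
move=> C [cut nomax] [c Cc].
have /choice[g hg] : forall s : seq S, exists a, C a /\ forall x, List.In x s -> C x -> lt x a.
  elim=> [|b s [a [Ca ha]]]; first by exists c.
  case: (pselect (C b)) => Cb; last by exists a; split=> // x [<-//|/ha].
  have [b1 [Cb1 bb1]] := nomax b Cb.
  have [ab|ba] : lt a b1 \/ a = b1 \/ lt b1 a by apply: tot.
    exists b1; split=> // x [<-//|xs Cx]; apply: tr ab; exact: ha.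
  exists a; split=> // x [<- _|//]; last exact: ha.
  by case: ba => [->//|]; apply: tr.
exists (uclass UF g); split=> x Cx.
  have h : U (cone [:: x]) by apply: FU; exists [:: x].
  apply: ultra_mono (ultra_and UF (ultra_and UF (ueq_class UF (fun _ => x)) (ueq_class UF g)) h).
  by move=> s [[/= -> ->] hs]; case: (hg s) => _; apply=> //; apply: hs; left.
apply: ultra_mono (ultra_and UF (ueq_class UF (fun _ => x)) (ueq_class UF g)).
by move=> s [/= -> ->]; case: (hg s) => Ca _; apply: cut.
Qed.

(** * Elementary substructures *)

Section Substructure.
Variables (L : language) (S : structure L) (A : S -> Prop).
Hypothesis inhA : exists a, A a.
Hypothesis tvA : tv A.

Lemma tv_fint n (f : func L n) (x : 'I_n -> S) : (forall i, A (x i)) -> A (fint f x).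
Proof.
move=> hx; have [a Aa] := inhA.
pose y k := if insub k is Some i then x i else a.
have yi (i : 'I_n) : y i = x i.
  by rewrite /y; case: insubP => [i' _ /val_inj->//|]; rewrite ltn_ord.
have hP : dfn A (fun v => v 0 = fint f (fun i : 'I_n => v i.+1)).
  by apply: dfn_eq; [exact: dfun_var|apply: dfun_app => // i; exact: dfun_var].
have [||z [Az]] := tvA hP (x := y); last by rewrite /=; under eq_fun do rewrite yi; move=> <-.
  by move=> k; rewrite /y; case: insub.
by exists (fint f x); rewrite /=; under [in RHS]eq_fun do rewrite yi.
Qed.

Definition substr : structure L :=
  @Structure L {x : S | A x} (fun x y => lt (sval x) (sval y))
    (fun n f x => exist _ (fint f (fun i => sval (x i))) (tv_fint f (fun i => svalP (x i))))
    (fun n r x => rint r (fun i => sval (x i))).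

Definition sub_val (x : substr) : S := sval x.

Lemma sub_val_in (x : substr) : A (sub_val x). Proof. exact: svalP. Qed.

Lemma sub_val_ex a : A a -> exists x, sub_val x = a.
Proof. by move=> Aa; exists (exist _ a Aa). Qed.

Lemma sub_val_inj x y : sub_val x = sub_val y -> x = y.
Proof.
case: x y => x Ax [y Ay]; rewrite /sub_val /= => E; subst y.
by congr exist; apply: Prop_irrelevance.
Qed.

Lemma sub_image a : (exists x, sub_val x = a) <-> A a.
Proof. by split=> [[x <-]|/sub_val_ex//]; apply: sub_val_in. Qed.

Lemma sub_elementary : elementary sub_val.
Proof.
have ev (e : nat -> substr) t : sub_val (eval e t) = eval (fun k => sub_val (e k)) t.
  elim: t => [k|n f ts IH] //=; rewrite /sub_val /=; congr fint.
  by apply: funext => i; apply: IH.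
elim=> [t u|t u|n r ts||p IHp q IHq|p IH] e /=.
- by rewrite -!ev; split=> [->//|/sub_val_inj].
- by rewrite -!ev.
- by under [X in _ <-> _ X]eq_fun do rewrite -ev.
- by [].
- by rewrite IHp IHq.
- have E a : (fun k => sub_val (push a e k)) = push (sub_val a) (fun k => sub_val (e k)).
    by apply: funext => -[].
  split=> H a; last by apply/IH; rewrite E.
  apply: (@tv_all _ _ A (fun x => sat x p)) => // [||z /sub_val_ex[b <-]].
  + exact: dfn_atom.
  + by move=> k; apply: sub_val_in.
  + by rewrite -E; apply/IH.
Qed.

Lemma sub_pull P : dfn A P -> dfn (fun _ : substr => True) (fun x => P (fun k => sub_val (x k))).
Proof.
by move=> hP; apply: (dfn_pull sub_elementary); apply: dfn_mono hP => a /sub_image.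
Qed.

Lemma sub_list l : (forall e, List.In e l -> A e) -> exists l', List.map sub_val l' = l.
Proof.
elim: l => [_|a l IH h]; first by exists nil.
have [|l' <-] := IH; first by move=> e he; apply: h; right.
by have [|x <-] := @sub_val_ex a; [apply: h; left|exists (x :: l')].
Qed.

(** A definable set of the substructure is the trace of a set definable over [A], and because the
    endpoints lie in [A] its decomposition survives the restriction. *)
Lemma sub_omin add zero opp : ordered_group (@lt L substr) add zero opp ->
  (forall X, dfn1 A X -> tame A X) -> o_minimal substr.
Proof.
move=> hg tameA X /definable1_dfn[p [e [_ h]]].
have {h} h x : X x <-> sat (mix (fun _ => sub_val x) (fun k => sub_val (e k))) p.
  rewrite (h (fun _ => x)) (sub_elementary p).
  suff -> : (fun k => sub_val (mix (fun _ => x) e k)) =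
            mix (fun _ => sub_val x) (fun k => sub_val (e k)) by [].
  by apply: funext => k; rewrite /mix; case: ifP.
have [|l [lA hl]] := tameA (fun z => sat (mix (fun _ => z) (fun k => sub_val (e k))) p).
  exists (fren (fun k => if odd k then k else 0) p), (fun k => sub_val (e k)); split.
    by move=> k; apply: sub_val_in.
  move=> x; rewrite sat_fren.
  suff -> : (fun k => mix x (fun i => sub_val (e i)) (if odd k then k else 0)) =
    mix (fun _ => x 0) (fun k => sub_val (e k)) by [].
  by apply: funext => k; rewrite /mix; case E: (odd k); rewrite ?E.
have [l' El] := sub_list lA.
have [|s [_ hs]] := @tame_pieces _ _ _ _ _ hg (fun _ => True) X; last by exists s.
exists l'; split=> // x y xy /h hx; apply/h; apply: hl hx => e' he'.
have : List.In e' (List.map sub_val l') by rewrite El.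
by case/List.in_map_iff => b [<- hb]; apply: xy.
Qed.

End Substructure.

(** * Finite definable sets and boundary points *)

Section FiniteDefinable.
Variables (L : language) (S : structure L) (add : S -> S -> S) (zero : S) (opp : S -> S).
Hypothesis hg : ordered_group (@lt L S) add zero opp.
Hypothesis nomin : forall x : S, exists y, lt y x.
Hypothesis nomax : forall x : S, exists y, lt x y.
Implicit Types (A X : S -> Prop).

Local Ltac order := order_with hg.

(** The least element is definable; it is removed and the rest follows by induction on the list. *)
Lemma finite_dcl A X l : dfn1 A X -> (forall z, X z -> List.In z l) ->
  forall z, X z -> dcl A z.
Proof.
have [n] : exists n, (size l <= n)%N by exists (size l).
elim: n l X => [|n IH] l X ln hX hl z Xz.
  by case: l ln hl => // _ /(_ z Xz).
have inhA := dfn_inhab hX; have [m [Xm hm]] := list_min hg Xz hl.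
have dm : dcl A m.
  have : dfn1 A (fun x => X x /\ forall y, X y -> ~ lt y x) by defin.
  apply: dfn_ext => x; split=> [[Xx hx]|->] //.
  by have := hx m Xm; have := hm _ Xx; order.
have [<-//|mz] := pselect (m = z).
have [l1 [l2 E]] := List.in_split _ _ (hl m Xm).
apply: (IH (l1 ++ l2)%list (fun x => X x /\ ~ x = m)); last by split=> // zm; apply: mz.
- by move: ln; rewrite E !size_cat /= addnS.
- by defin.
move=> y [Xy ym]; have := hl y Xy; rewrite E => /List.in_app_iff[h|[h|h]].
- by apply/List.in_app_iff; left.
- by case: ym.
- by apply/List.in_app_iff; right.
Qed.

Lemma chain_mono n X Y y : (forall z, X z -> Y z) -> chain n X y -> chain n Y y.
Proof.
move=> XY; elim: n y => [//|n IH] y [z [yz [Xz hz]]].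
by exists z; split=> //; split; [apply: XY|apply: IH].
Qed.

(** A nonempty set without least element contains arbitrarily long chains; otherwise the least
    element is removed and [n] decreases. *)
Lemma chain_finite n X : (forall z, X z -> ~ chain n X z) -> exists l, forall z, X z -> List.In z l.
Proof.
elim: n X => [|n IH] X hX; first by exists nil => z /hX; case.
case: (pselect (exists m, X m /\ forall y, X y -> ~ lt y m)) => [[m [Xm hm]]|nomin'].
  have [|l hl] := IH (fun z => X z /\ lt m z).
    move=> z [Xz mz] hz; apply: (hX m Xm); exists z; do 2!split=> //.
    by apply: chain_mono hz => w [].
  exists (m :: l) => z Xz; case: (pselect (m = z)) => E; [by left|right].
  by apply: hl; split=> //; have := hm z Xz; order.
exists nil => z Xz; exfalso.
have [k [Xk hk]] : exists k, X k /\ chain n.+1 X k; last exact: hX hk.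
elim: (n.+1) => [|k [y [Xy hy]]]; first by exists z.
have [w [Xw wy]] : exists w, X w /\ lt w y.
  by apply: contrapT => h; apply: nomin'; exists y; split=> // w Xw wy; apply: h; exists w.
by exists w; split=> //; exists y.
Qed.

(** The points that are not regular are the boundary points of [X], the endpoints that a
    decomposition of [X] has to use. *)
Definition regular X y := exists u v, lt u y /\ lt y v /\
  forall w w', lt u w -> lt w v -> lt u w' -> lt w' v -> X w -> X w'.

Lemma tame_regular E X : tame E X ->
  exists l, (forall e, List.In e l -> E e) /\ forall y, ~ regular X y -> List.In y l.
Proof.
move=> [l [lE hl]]; exists l; split=> // y nr; apply: contrapT => yl; apply: nr.
have [[a ay] [b yb]] := (nomin y, nomax y).
have [v [yv [_ hv]]] := avoid_right hg l yb; have [u [uy [_ hu]]] := avoid_left hg l ay.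
exists u, v; do 2!split=> //; move=> w w' uw wv uw' wv'; apply: hl => e he.
have := hv _ he; have := hu _ he.
have ye : y <> e by move=> ?; subst.
by split; split; order.
Qed.

Hypothesis dense : forall x y : S, lt x y -> exists z, lt x z /\ lt z y.
Local Notation "x < y" := (lt x y).

Lemma regular_constant X (u v : S) : (forall y, ~ y < u -> ~ v < y -> regular X y) -> ~ v < u ->
  (exists E, tame E X) -> X u -> X v.
Proof.
move=> reg uv [E hX].
have [u1 [u2 [u1u [uu2 hu]]]] : regular X u by apply: reg => //; order.
have [v1 [v2 [v1v [vv2 hv]]]] : regular X v by apply: reg => //; order.
apply: (tame_locally_constant hg dense hX (u := u1) (v := v2)); try by order.
move=> z u1z zv2; case: (pselect (z < u)) => zu; first by exists u1, u2; split; [order|split; [order|exact: hu]].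
case: (pselect (v < z)) => vz; first by exists v1, v2; split; [order|split; [order|exact: hv]].
by have [a' [b' h]] := reg z zu vz; exists a', b'.
Qed.

End FiniteDefinable.

(** * Adjoining a realization of a cut *)

Section Good.
Variables (L L' : language) (M S : structure L) (j : M -> S).
Variables (f' : forall n, func L' n -> ('I_n -> M) -> M)
          (r' : forall n, Defs.rel L' n -> ('I_n -> M) -> Prop).
Let M' := @Structure L' M (@lt L M) f' r'.
Variables (plus : func L 2) (zero : M) (opp : M -> M) (zeroS : S) (oppS : S -> S).
Hypothesis hgM : ordered_group (@lt L M) (binop plus) zero opp.
Hypothesis denseM : forall x y : M, lt x y -> exists z, lt x z /\ lt z y.
Hypothesis nominM : forall x : M, exists y, lt y x.
Hypothesis nomaxM : forall x : M, exists y, lt x y.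
Hypothesis hj : elementary j.
Hypothesis hgS : ordered_group (@lt L S) (binop plus) zeroS oppS.
Hypothesis denseS : forall x y : S, lt x y -> exists z, lt x z /\ lt z y.
Hypothesis nominS : forall x : S, exists y, lt y x.
Hypothesis nomaxS : forall x : S, exists y, lt x y.
Hypothesis nonval : forall P : M -> Prop, dfn1 (fun _ : M' => True) P ->
  (forall x y, lt x y -> P y -> P x) -> (exists x, P x) -> (exists x, ~ P x) ->
  forall e, lt zero e -> exists p, P p /\ ~ P (binop plus p e).
Implicit Types (A B : S -> Prop) (P Q : (nat -> S) -> Prop).
Local Notation "x < y" := (lt x y).
Local Notation "x + y" := (binop plus x y).

(* Candidates for (the universe of) the structure of which [M'] is the trace. *)
Record good A : Prop := Good {
  good_base : forall m, A (j m);
  good_tame : forall X, dfn1 A X -> tame A X;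
  good_dense : forall x y, A x -> A y -> x < y -> exists m, x < j m /\ j m < y;
  good_unbounded : forall x, A x -> (exists m, j m < x) /\ (exists m, x < j m);
  good_trace : forall P, dfn A P -> dfn (fun _ : M' => True) (fun x => P (fun k => j (x k)))
}.

Lemma good_inhab A : good A -> exists a, A a.
Proof. by move=> gA; exists (j zero); apply: good_base. Qed.

(** A nonempty set definable over [A] contains a point of [A] or an interval with ends in [A] or
    infinite, and such an interval meets M. *)
Lemma good_tv A : good A -> tv A.
Proof.
move=> gA P hP x hx [z Pz].
have [s [sA hs]] := tame_pieces hgS (good_tame gA (dfn_inst hP hx)).
have [piece [hp zp]] := iffLR (List.Exists_exists _ _) (iffLR (hs z) Pz).
have {}hs w : in_piece w piece -> P (push w x).
  by move=> wp; apply/hs/List.Exists_exists; exists piece.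
have := iffLR (List.Forall_forall _ _) sA piece hp.
case: piece hp zp hs => [a|lo hi] hp /= zp hs hA; first by exists a; split=> //; apply: hs.
suff [m hm] : exists m, (if lo is Some a then a < j m else True) /\
                        (if hi is Some b then j m < b else True).
  by exists (j m); split; [apply: good_base|apply: hs].
case: lo hi hA zp {hp hs} => [a|] [b|] [hA hB] [az zb].
- by apply: (good_dense gA) => //; exact: (og_trans hgS az zb).
- by have [_ [m hm]] := good_unbounded gA hA; exists m.
- by have [[m hm] _] := good_unbounded gA hB; exists m.
- by exists zero.
Qed.

Section OneStep.
Variables (A : S -> Prop) (C : M -> Prop) (a : S).
Hypothesis gA : good A.
Hypothesis dC : dfn1 (fun _ : M' => True) C.
Hypothesis cutC : is_cut (@lt L M) C.
Hypothesis exC : exists x, C x.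
Hypothesis exnC : exists x, ~ C x.
Hypothesis below : forall x, C x -> j x < a.
Hypothesis above : forall x, ~ C x -> a < j x.
Hypothesis unrealized : forall b, A b -> ~ forall m, C m <-> j m < b.

Let inhA := good_inhab gA.
Let tvA := good_tv gA.
Let baseA := good_base gA.
Local Notation sub := (substr inhA tvA).
Local Notation val := (@sub_val L S A inhA tvA).
Local Notation all := (fun _ : sub => True).

Local Ltac order := order_with hgS.
Local Ltac orderM := order_with hgM.

Lemma C_lower x y : x < y -> C y -> C x.
Proof.
move=> xy Cy; apply: contrapT => nCx; have yx := cutC.1 y x Cy nCx; orderM.
Qed.

Lemma C_lt m : C m <-> j m < a.
Proof. by split=> [/below//|h]; apply: contrapT => /above; order. Qed.

(** If no point of [C] came after [b], then [b] would itself realize the cut. *)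
Lemma above_lt b : A b -> b < a -> exists m, C m /\ b < j m.
Proof.
move=> Ab ba; apply: contrapT => h; apply: (unrealized Ab) => m; split=> [Cm|mb].
  have [n [Cn mn]] := cutC.2 m Cm.
  have /(elementary_lt hj) := mn; have : ~ b < j n by move=> bn; apply: h; exists n.
  by order.
by apply/C_lt; order.
Qed.

Lemma below_gt b : A b -> ~ b < a -> exists m, ~ C m /\ j m < b.
Proof.
move=> Ab ba; apply: contrapT => h; apply: (unrealized Ab) => m; split=> [/C_lt|mb].
  by order.
by apply: contrapT => nC; apply: h; exists m.
Qed.

Lemma a_fresh b : A b -> b <> a.
Proof. by move=> Ab E; subst b; apply: (unrealized Ab) => m; apply: C_lt. Qed.

Definition sub_cut (x : sub) := val x < a.

Lemma sub_cut_gap : gap_cut sub_cut.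
Proof.
split; first by move=> x y xy; apply: (og_trans hgS).
split; first by have [m Cm] := exC; have [x hx] := sub_val_ex inhA tvA (baseA m); exists x; rewrite /sub_cut hx; apply: below.
split.
  have [m Cm] := exnC; have [x hx] := sub_val_ex inhA tvA (baseA m).
  by exists x; rewrite /sub_cut hx; have := above Cm; order.
split=> x hx.
  have [m [Cm xm]] := above_lt (sub_val_in x) hx.
  have [y hy] := sub_val_ex inhA tvA (baseA m).
  exists y; split; first by rewrite /sub_cut hy; apply: below.
  by rewrite -hy in xm.
have [m [Cm xm]] := below_gt (sub_val_in x) hx.
have [y hy] := sub_val_ex inhA tvA (baseA m).
exists y; split; first by rewrite /sub_cut hy; have := above Cm; order.
by rewrite -hy in xm.
Qed.

Definition near_a (X : S -> Prop) :=
  exists m m', C m /\ ~ C m' /\ forall z, j m < z -> z < j m' -> X z.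

(** The cut determines the type of [a] over [A]: the endpoints of [X] lie in [A], so elements of M
    separate them from [a]. *)
Lemma dfn_near X : dfn1 A X -> X a -> near_a X.
Proof.
move=> /(good_tame gA)[l [lA hl]] Xa.
have [m [m' [Cm [Cm' hmm]]]] : exists m m', C m /\ ~ C m' /\
    forall e, List.In e l -> j m < e -> ~ e < j m'.
  elim: l lA {hl} => [_|e l IH lA]; first by have [[m hm] [m' hm']] := (exC, exnC); exists m, m'.
  have [|m [m' [Cm [Cm' h]]]] := IH; first by move=> b hb; apply: lA; right.
  have Ae : A e by apply: lA; left.
  have [ea|ea] := pselect (e < a).
    have [n [Cn en]] := above_lt Ae ea.
    have [k [k1 [k2 k3]]] := max2 hgM m n; exists k, m'; split; first by case: k1 => ->.
    split=> // b [<-|hb] kb.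
      have : ~ j k < j n by move/(elementary_lt hj). by order.
    apply: (h b hb); have : ~ j k < j m by move/(elementary_lt hj). by order.
  have [n [Cn en]] := below_gt Ae ea.
  have [k [k1 [k2 k3]]] := min2 hgM m' n; exists m, k; split=> //; split; first by case: k1 => ->.
  move=> b [<-|hb] mb.
    have : ~ j n < j k by move/(elementary_lt hj). by order.
  have := h b hb mb; have : ~ j m' < j k by move/(elementary_lt hj). by order.
exists m, m'; split=> //; split=> // z mz zm; apply: hl Xa => e he.
have := below Cm; have := above Cm'; have := hmm e he; have := a_fresh (lA e he).
by move=> *; split; split; order.
Qed.

Lemma near_a_C (X : S -> Prop) : near_a X -> exists m, C m /\ X (j m).
Proof.
move=> [m [m' [Cm [Cm' H]]]]; have [n [Cn mn]] := cutC.2 m Cm.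
exists n; split=> //; apply: H; first exact/(elementary_lt hj).
exact/(elementary_lt hj)/cutC.1.
Qed.

Lemma near_a_and (X Y : S -> Prop) : near_a X -> near_a Y -> near_a (fun z => X z /\ Y z).
Proof.
move=> [m [m' [Cm [Cm' H]]]] [n [n' [Cn [Cn' H']]]].
have [k [k1 [k2 k3]]] := max2 hgM m n; have [k' [k'1 [k'2 k'3]]] := min2 hgM m' n'.
exists k, k'; split; first by case: k1 => ->.
split; first by case: k'1 => ->.
have h1 : ~ j k < j m by move/(elementary_lt hj).
have h2 : ~ j k < j n by move/(elementary_lt hj).
have h3 : ~ j m' < j k' by move/(elementary_lt hj).
have h4 : ~ j n' < j k' by move/(elementary_lt hj).
by move=> z kz zk; split; [apply: H|apply: H']; order.
Qed.

Lemma near_at X : dfn1 A X -> near_cut sub_cut (fun t => X (val t)) -> X a.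
Proof.
move=> hX [p [q [Kp [Kq H]]]]; apply: contrapT => nX.
have [m [m' [Cm [Cm' Hm]]]] := @dfn_near (fun z => ~ X z) (dfn_not hX) nX.
have [n [Cn pn]] := above_lt (sub_val_in p) Kp.
have [n' [Cn' nq]] := below_gt (sub_val_in q) Kq.
have [] := @near_a_C (fun z => ~ X z /\ (val p < z /\ z < val q)).
  apply: near_a_and; first by exists m, m'.
  exists n, n'; split=> //; split=> // z nz zn; split; order.
move=> k [Ck [nXk [pk kq]]]; have [t ht] := sub_val_ex inhA tvA (baseA k).
by apply: nXk; rewrite -ht in pk kq *; apply: H.
Qed.

Lemma near_a_cut X : near_a X -> near_cut sub_cut (fun t => X (val t)).
Proof.
move=> [m [m' [Cm [Cm' H]]]].
have [p hp] := sub_val_ex inhA tvA (baseA m); have [q hq] := sub_val_ex inhA tvA (baseA m').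
exists p, q; split; first by rewrite /sub_cut hp; apply: below.
split; first by rewrite /sub_cut hq; have := above Cm'; order.
by move=> x px xq; apply: H; rewrite -?hp -?hq.
Qed.

Lemma sub_group : exists zero' opp', ordered_group (@lt L sub) (@binop L sub plus) zero' opp'.
Proof.
have [x _] := sub_val_ex inhA tvA (baseA zero).
apply: (ordered_group_transfer (S1 := S) (S2 := sub) _ x hgS) => p h.
exact: (iffRL (elementary_valid (@sub_elementary L S A inhA tvA) p x) h).
Qed.

Lemma sub_unbounded : (forall x : sub, exists y, lt y x) /\ (forall x : sub, exists y, lt x y).
Proof.
split=> x; have [[m hm] [m' hm']] := good_unbounded gA (sub_val_in x).
  by have [y hy] := sub_val_ex inhA tvA (baseA m); exists y; rewrite -hy in hm.
by have [y hy] := sub_val_ex inhA tvA (baseA m'); exists y; rewrite -hy in hm'.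
Qed.

Lemma sub_dense (x y : sub) : lt x y -> exists z, lt x z /\ lt z y.
Proof.
move/(good_dense gA (sub_val_in x) (sub_val_in y)) => [m [xm my]].
by have [z hz] := sub_val_ex inhA tvA (baseA m); exists z; rewrite -hz in xm my.
Qed.

Lemma sub_o_minimal : o_minimal sub.
Proof. by have [z' [o' hg']] := sub_group; apply: (sub_omin hg'); apply: good_tame gA. Qed.

(** The bound near the cut, proved in the substructure on [A] and read at [a]: a quantity attached
    to [a] is replaced by one in [A]. *)
Lemma uniform_at G : dfn2 A G -> nested G -> (exists u, G a u) -> exists u, A u /\ G a u.
Proof.
move=> hG nG exa; have [z' [o' hg']] := sub_group.
have hE : dfn1 A (fun t => exists u, G t u) by defin.
have [||||u hu] := @uniform_near _ _ _ _ _ hg' sub_o_minimal sub_dense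
    sub_unbounded.1 sub_unbounded.2 (fun t u => G (val t) (val u)) sub_cut.
- exact: (sub_pull inhA tvA hG).
- by move=> t s; have [h|h] := nG (val t) (val s); [left|right] => u; apply: h.
- exact: sub_cut_gap.
- apply: near_mono (near_a_cut (dfn_near hE exa)) => t [u Gtu].
  have hP : dfn A (fun x => G (x 1) (x 0)) by defin.
  have [||v [Av Gv]] := tvA hP (x := fun _ => val t).
  + by move=> _; apply: sub_val_in.
  + by exists u.
  by have [v' Ev] := sub_val_ex inhA tvA Av; exists v'; rewrite Ev.
exists (val u); split; first exact: sub_val_in.
apply: (@near_at (fun t => G t (val u))) => //.
by have Au := sub_val_in u; defin.
Qed.

Definition adj b := A b \/ b = a.

Let inhB : exists b, adj b. Proof. by exists (j zero); left. Qed.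

Lemma adj_dfn P : dfn (dcl adj) P ->
  exists Q, dfn A Q /\ forall x, P x <-> Q (push a x).
Proof. by move=> hP; apply: dfn_add inhA (dfn_dcl inhB hP). Qed.

(** Sets definable over [A] and [a] are fibres at [a] of families over [A]. The variables after the
    first are filled with [j zero], some element of [A]. *)
Lemma adj_fiber P : dfn (dcl adj) P -> exists G, dfn2 A G /\
  forall z, P (push z (fun _ => j zero)) <-> G a z.
Proof.
move=> /adj_dfn[Q [hQ PQ]].
exists (fun t z => Q (push t (push z (fun _ => j zero)))); split=> [|z]; last exact: PQ.
apply: (@dfn_subst _ _ _ (fun _ => j zero)
  (fun b x => Q (push (x 0) (push (x 1) (fun _ => b))))); first exact: dcl_sub.
pose r k := match k with 0 => 1 | 1 => 2 | _ => 0 end.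
apply: dfn_ext (dfn_ren r hQ) => x.
by rewrite (_ : push _ _ = fun k => x (r k)); last by apply: funext => -[|[|k]].
Qed.

Lemma adj_point b : dcl adj b -> exists G, dfn2 A G /\ forall z, G a z <-> z = b.
Proof.
move=> hb; have [|G [hG h]] := @adj_fiber (fun x => x 0 = b).
  by apply: dfn_mono hb => *; apply: dcl_sub.
by exists G; split=> // z; rewrite -h.
Qed.

Lemma extend_unbounded b : dcl adj b -> (exists m, j m < b) /\ (exists m, b < j m).
Proof.
move=> /adj_point[G [hG Gb]]; split.
  have [|||u [Au Gu]] := @uniform_at (fun t u => forall z, G t z -> u < z).
  - by defin.
  - by apply: (nested_down hgS) => t u v vu H z /H; order.
  - by have [u ub] := nominS b; exists u => z /Gb ->.
  have ub : u < b by apply: Gu; apply/Gb.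
  by have [[m mu] _] := good_unbounded gA Au; exists m; order.
have [|||u [Au Gu]] := @uniform_at (fun t u => forall z, G t z -> z < u).
- by defin.
- by apply: (nested_up hgS) => t u v vu H z /H; order.
- by have [u ub] := nomaxS b; exists u => z /Gb ->.
have ub : b < u by apply: Gu; apply/Gb.
by have [_ [m mu]] := good_unbounded gA Au; exists m; order.
Qed.

(** For arguments in M, a condition on [a] holds iff it holds at all points of M in an interval
    around the cut, and this is definable in [M'] because [C] is. *)
Lemma extend_trace P : dfn (dcl adj) P -> dfn (fun _ : M' => True) (fun x => P (fun k => j (x k))).
Proof.
move=> /adj_dfn[Q [hQ PQ]].
have inhM : exists m : M', True by exists zero.
have hT := good_trace gA hQ.
have hle : dfn2 (fun _ : M' => True) (@lt L M).
  by apply: (@dfn_lt L' M'); apply: dfun_var.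
have : dfn (fun _ : M' => True) (fun x => exists m m', C m /\ ~ C m' /\
    forall t, lt m t -> lt t m' -> Q (fun k => j (push t x k))).
  apply: (@dfn_ex _ M' _ (fun m x => exists m', C m /\ ~ C m' /\
    forall t, lt m t -> lt t m' -> Q (fun k => j (push t x k)))).
  apply: (@dfn_ex _ M' _ (fun m' x => C (x 0) /\ ~ C m' /\
    forall t, lt (x 0) t -> lt t m' -> Q (fun k => j (push t (fun k => x k.+1) k)))).
  apply: dfn_and; first by defin.
  apply: dfn_and; first by defin.
  apply: (@dfn_all _ M' _ (fun t x => lt (x 1) t -> lt t (x 0) ->
    Q (fun k => j (push t (fun k => x k.+2) k)))).
  apply: dfn_imp; first by defin.
  apply: dfn_imp; first by defin.
  pose r k := if k is k'.+1 then k'.+3 else 0.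
  apply: dfn_ext (@dfn_ren _ M' _ _ r hT) => x.
  by rewrite (_ : (fun k => j (push _ _ k)) = fun k => j (x (r k))); last by apply: funext => -[].
apply: dfn_ext => x.
have E t : (fun k => j (@push L M t x k)) = push (j t) (fun k => j (x k)).
  by apply: funext => -[].
pose X z := Q (push z (fun k => j (x k))).
have hX : dfn1 A X by apply: dfn_inst => // k; apply: baseA.
rewrite PQ; split=> [[m [m' [Cm [Cm' H]]]]|h]; last first.
  have [m [m' [Cm [Cm' H]]]] := dfn_near hX h.
  exists m, m'; split=> //; split=> // t mt tm; rewrite E; apply: H; exact/(elementary_lt hj).
apply: contrapT => nQ.
have nX := @dfn_near (fun z => ~ X z) (dfn_not hX) nQ.
have nm : near_a (fun z => j m < z /\ z < j m') by exists m, m'.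
have [t [Ct [nXt [/(elementary_lt hj) mt /(elementary_lt hj) tm]]]] := near_a_C (near_a_and nX nm).
by apply: nXt; rewrite /X -E; apply: H.
Qed.

Let jadd x y : j (x + y) = j x + j y. Proof. exact: (elementary_binop hj). Qed.

Lemma jpos e : lt zero e <-> zeroS < j e.
Proof.
by rewrite -(lt_addr_pos hgM e e) (elementary_lt hj) jadd (lt_addr_pos hgS).
Qed.

Lemma A_zero : A zeroS.
Proof.
have : dfn A (fun v => v 0 + v 0 = v 0) by defin.
move=> h0; have [||z [Az /= Ez]] := tvA h0 (x := fun _ => j zero).
- by move=> _; apply: baseA.
- by exists zeroS; rewrite /= (og_add0 hgS).
by have := congr1 (binop plus (oppS z)) Ez; rewrite (addKr hgS) (og_addN hgS) => <-.
Qed.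

Lemma extend_dense x y : dcl adj x -> dcl adj y -> x < y -> exists m, x < j m /\ j m < y.
Proof.
move=> hx hy xy; have [G [hG Gx]] := adj_point hx; have [G' [hG' Gy]] := adj_point hy.
have [[l lx] [r xr]] := extend_unbounded hx; have A0 := A_zero.
(* The distance from [x] to [y] is at least some positive [e] in [A]. *)
have [|||e [Ae [e0 He]]] :=
  @uniform_at (fun t u => zeroS < u /\ forall z z', G t z -> G' t z' -> ~ z' < z + u).
- by defin.
- apply: (nested_pos hgS) => t u v v0 vu H z z' Gz Gz'.
  by have := H z z' Gz Gz'; have /(og_lt_addl hgS z) := vu; order.
- exists (oppS x + y); split; first by apply/(lt_addr_pos hgS x); rewrite (addNKr hgS).
  by move=> z z' /Gx -> /Gy ->; rewrite (addNKr hgS); order.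
have {}He : ~ y < x + e by apply: He; [apply/Gx|apply/Gy].
have [e1 [/jpos e10 e1e]] := good_dense gA A_zero Ae e0.
have [s [s0 se]] := half_pos hgM denseM e10.
(* The cut of [x] in M is definable in [M'] by [extend_trace], so a step [s] crosses it. *)
have [||||p [px nps]] := @nonval (fun m => j m < x) _ _ _ _ s s0.
- have hx' : dfn (dcl adj) (fun v => v 0 < x).
    have inhB' : exists b, dcl adj b by exists x.
    by apply: dfn_lt; [exact: dfun_var|apply: dcl_sub].
  exact: (extend_trace hx').
- by move=> m n /(elementary_lt hj) mn; order.
- by exists l.
- by exists r; order.
have sp : zeroS < j s by apply/jpos.
(* One step may land exactly on [x]; the second one makes the inequality strict, and both together
   stay below [e1]. *)
exists (p + s + s); split.
  by rewrite jadd; have /(lt_addr_pos hgS (j (p + s))) := sp; order.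
rewrite -(og_addA hgM) jadd.
have h1 : j p + j (s + s) < x + j (s + s) by apply/(ltD2r hgS).
have h2 : ~ x + j e1 < x + j (s + s) by move/(ltD2l hgS)/(elementary_lt hj).
have h3 : x + j e1 < x + e by apply/(ltD2l hgS).
order.
Qed.

Lemma dfn_regular phi : dfn2 A phi -> dfn2 A (fun t y => regular (phi t) y).
Proof. by move=> hphi; rewrite /regular; defin. Qed.

Lemma dfn_chain (R : S -> S -> Prop) n : dfn2 A R -> dfn2 A (fun t y => chain n (R t) y).
Proof.
move=> hR; elim: n => [|n IH] /=; first exact: dfn_prop.
pose Rn t y := chain n (R t) y; have hRn : dfn2 A Rn := IH.
by change (dfn2 A (fun t y => exists z, y < z /\ R t z /\ Rn t z)); defin.
Qed.

Lemma chain_val (R : S -> S -> Prop) n (t y : sub) : dfn2 A R ->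
  chain n (R (val t)) (val y) <-> chain n (fun z : sub => R (val t) (val z)) y.
Proof.
move=> hR; elim: n y => [//|n IH] y /=; split=> [h|[z [yz [Rz /IH hz]]]]; last by exists (val z).
pose Rn t y := chain n (R t) y; have hRn : dfn2 A Rn by apply: dfn_chain.
have hP : dfn A (fun x => x 1 < x 0 /\ R (x 2) (x 0) /\ Rn (x 2) (x 0)) by defin.
have [||w [Aw [/= yw [Rw hw]]]] := tvA hP (x := fun k => if k is 0 then val y else val t).
- by case=> [|k]; apply: sub_val_in.
- by case: h => z hz; exists z.
have [z Ez] := sub_val_ex inhA tvA Aw; rewrite -Ez in yw Rw hw.
by exists z; split=> //; split=> //; apply/IH.
Qed.

Let vadd (x y : sub) : val (x + y) = val x + val y.
Proof. exact: (elementary_binop (@sub_elementary L S A inhA tvA)). Qed.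

Lemma good_irregular phi t : dfn2 A phi -> A t ->
  exists l, (forall e, List.In e l -> A e) /\ forall y, ~ regular (phi t) y -> List.In y l.
Proof.
move=> hphi At; apply: (tame_regular hgS nominS nomaxS (E := A)).
by apply: good_tame gA _ _; defin.
Qed.

(* By uniform finiteness in [A] near the cut, the fibre at [a] has finitely many
   irregular points, each of them definable from [a]. *)
Lemma irregular_at phi : dfn2 A phi ->
  exists l, (forall e, List.In e l -> dcl adj e) /\ forall y, ~ regular (phi a) y -> List.In y l.
Proof.
move=> hphi; pose bd t y := ~ regular (phi t) y.
have hreg := dfn_regular hphi.
have hbd : dfn2 A bd by apply: dfn_not; exact: hreg.
have [z' [o' hg']] := sub_group.
have [|||n hn] := @finite_near _ _ _ _ _ hg' sub_o_minimal sub_dense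
    sub_unbounded.1 sub_unbounded.2 (fun t y => bd (val t) (val y)) sub_cut _ sub_cut_gap.
- exact: (sub_pull inhA tvA hbd).
(* Nonvaluationality is known for steps in M, so a positive element of M below [r] is used. *)
- move=> r r0; have {}r0 : zeroS < val r.
    apply/(lt_addr_pos hgS (val r)).
    by have /(lt_addr_pos hg' r)/(elementary_lt (@sub_elementary L S A inhA tvA)) := r0; rewrite vadd.
  have [e [/jpos e0 er]] := good_dense gA A_zero (sub_val_in r) r0.
  have [m [Cm nCm]] := nonval dC C_lower exC exnC e0.
  have [p Ep] := sub_val_ex inhA tvA (baseA m).
  have [q Eq'] := sub_val_ex inhA tvA (baseA (m + e)).
  exists p, q; split; first by rewrite /sub_cut Ep; apply: below.
  split; first by rewrite /sub_cut Eq'; have := above nCm; order.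
  move/(elementary_lt (@sub_elementary L S A inhA tvA)); rewrite vadd Ep Eq' jadd.
  by move/(ltD2l hgS); order.
- move=> t; have [l [lA hl]] := good_irregular hphi (sub_val_in t).
  have [l' El] := sub_list inhA tvA lA; exists l' => y /hl; rewrite -El.
  by case/List.in_map_iff => b [/sub_val_inj <-].
pose E t := forall z, bd t z -> ~ chain n (bd t) z.
have hE : dfn1 A E.
  pose Rn t y := chain n (bd t) y; have hRn : dfn2 A Rn by apply: dfn_chain.
  by change (dfn1 A (fun t => forall z, bd t z -> ~ Rn t z)); defin.
have Ea : E a.
  apply: near_at => //; apply: near_mono hn => t ht z bz.
  have Az : A z by have [l [lA hl]] := good_irregular hphi (sub_val_in t); apply/lA/hl.
  have [y Ey] := sub_val_ex inhA tvA Az; rewrite -Ey in bz * => hc.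
  by apply: (ht y) => //; apply/chain_val.
have [l hl] := chain_finite hgS Ea.
(* The list bounding the irregular points may contain others, which need not be definable from
   [a]. *)
exists (List.filter (fun e => `[< bd a e >]) l); split=> [e|y by_]; last first.
  by apply/List.filter_In; split; [apply: hl|apply/asboolP].
move=> /List.filter_In[_ /asboolP be]; apply: (finite_dcl hgS _ hl be).
have hbd' : dfn2 adj bd by apply: dfn_mono hbd => b; left.
by apply: (dfn2_app hbd'); [apply: dcl_sub; right|apply: dfun_var].
Qed.

(** Constancy between consecutive irregular points follows from tameness for fibres over [A]. Being
    a first-order statement [cst] about the parameter, it passes to all parameters in S by
    Tarski-Vaught, in particular to [a]. *)
Lemma extend_tame X : dfn1 (dcl adj) X -> tame (dcl adj) X.
Proof.
move=> /adj_fiber[phi [hphi hX]].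
have [l [lB hl]] := irregular_at hphi; exists l; split=> // x y xy; rewrite !hX.
have hreg := dfn_regular hphi.
pose rg t y := regular (phi t) y; have hrg : dfn2 A rg := hreg.
pose cst t := forall u v, (forall y, ~ y < u -> ~ v < y -> rg t y) -> ~ v < u ->
  (phi t u <-> phi t v).
have hc : dfn1 A cst by rewrite /cst; defin.
have ca : cst a.
  apply: (tv_univ tvA hc) => t At u v reg uv.
  have tm : tame A (phi t) by apply: good_tame gA _ _; defin.
  have tm' : tame A (fun z => ~ phi t z) by apply: good_tame gA _ _; defin.
  split; first by apply: (regular_constant hgS denseS) => //; exists A.
  apply: contraPP => /=.
  apply: (@regular_constant _ _ _ _ _ hgS denseS (fun z => ~ phi t z)) => //; last by exists A.
  move=> w wu vw; have [a' [b' [h1 [h2 h3]]]] := reg w wu vw.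
  exists a', b'; split=> //; split=> // p q ap pb aq qb np pq.
  by apply: np; apply: (h3 q).
have nb z : ~ rg a z -> List.In z l by apply: hl.
have side z : List.In z l -> (x < z <-> y < z) /\ (z < x <-> z < y) by apply: xy.
have [E|[->//|E]] := og_total hgS x y.
- have reg w : ~ w < x -> ~ y < w -> rg a w.
    move=> wx yw; apply: contrapT => /nb/side[s1 s2].
    by have [/s1|[E'|//]] := og_total hgS x w => //; subst w; have := s2.2 E; order.
  by apply: (iffLR (ca x y reg _)); order.
- have reg w : ~ w < y -> ~ x < w -> rg a w.
    move=> wy xw; apply: contrapT => /nb/side[s1 s2].
    by have [//|[E'|/s2//]] := og_total hgS x w; subst w; have := s1.2 E; order.
  by apply: (iffRL (ca y x reg _)); order.
Qed.

Lemma extend_good : good (dcl adj).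
Proof.
split.
- by move=> m; apply: dcl_sub; left; apply: baseA.
- exact: extend_tame.
- exact: extend_dense.
- exact: extend_unbounded.
- exact: extend_trace.
Qed.

End OneStep.
End Good.

(** * Maximal good sets *)

Section MaximalGood.
Local Open Scope classical_set_scope.
Variables (L L' : language) (M S : structure L) (j : M -> S).
Variables (f' : forall n, func L' n -> ('I_n -> M) -> M)
          (r' : forall n, Defs.rel L' n -> ('I_n -> M) -> Prop).
Let M' := @Structure L' M (@lt L M) f' r'.
Variables (plus : func L 2) (zero : M) (opp : M -> M).
Hypothesis hgM : ordered_group (@lt L M) (binop plus) zero opp.
Hypothesis minM : o_minimal M.
Hypothesis denseM : forall x y : M, lt x y -> exists z, lt x z /\ lt z y.
Hypothesis nominM : forall x : M, exists y, lt y x.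
Hypothesis nomaxM : forall x : M, exists y, lt x y.
Hypothesis hj : elementary j.
Hypothesis dfnM' : forall P : (nat -> M) -> Prop,
  dfn (fun _ : M => True) P -> dfn (fun _ : M' => True) P.
Local Notation good := (@good L L' M S j f' r').
Local Notation im := (fun b => exists a, j a = b).

(** Tameness in M, with its list of endpoints fixed, is a first-order statement, so it holds in S
    for the same endpoints. *)
Lemma good_image : good im.
Proof.
have tvi := elementary_tv hj.
have imj k : im (j k) by exists k.
split=> //.
- move=> X hX; have hXj := dfn_pull hj hX.
  have [l [_ hl]] := omin_tame hgM minM (X := fun m => X (j m)) hXj.
  exists (List.map j l); split; first by move=> e /List.in_map_iff[a [<- _]].
  pose pos l x y := forall e, List.In e (List.map j l) -> (lt x e <-> lt y e) /\ (lt e x <-> lt e y).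
  have inh : exists b, im b by exists (j zero); exists zero.
  have hpos : dfn2 im (pos l).
    elim: l {hl} => [|a l IH]; first by apply: dfn_ext (dfn_prop True inh) => x; split=> // _ e [].
    have ima := imj a.
    have h0 : dfn im (fun x => ((lt (x 0) (j a) <-> lt (x 1) (j a)) /\
      (lt (j a) (x 0) <-> lt (j a) (x 1))) /\ pos l (x 0) (x 1)) by defin.
    apply: dfn_ext h0 => x; split=> [[h1 h2] e [<-//|/h2//]|h].
    by split=> [|e he]; apply: h; [left|right].
  pose imp x y := pos l x y -> X x -> X y.
  have himp : dfn2 im imp by rewrite /imp; defin.
  apply: (@tv_univ _ _ _ (fun x => forall y, imp x y) tvi); first by defin.
  move=> _ [a <-]; have ima := imj a.
  apply: (@tv_univ _ _ _ (fun y => imp (j a) y) tvi); first by defin.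
  move=> _ [b <-] ab.
  apply: hl => e he; rewrite !(elementary_lt hj); apply: ab.
  exact: List.in_map.
- move=> _ _ [x <-] [y <-] /(elementary_lt hj)/denseM[z [xz zy]].
  by exists z; split; apply/(elementary_lt hj).
- move=> _ [x <-]; have [[y yx] [z xz]] := (nominM x, nomaxM x).
  by split; [exists y|exists z]; apply/(elementary_lt hj).
- by move=> P hP; apply: dfnM'; apply: (dfn_pull hj).
Qed.

(** A definition uses finitely many parameters, which already lie in one member of the chain. *)
Lemma good_chain (F : set (set S)) : (exists A, F A) -> (forall A, F A -> good A) ->
  total_on F subset -> good (\bigcup_(A in F) A).
Proof.
move=> [A0 FA0] gF tot.
have sub A : F A -> forall b, A b -> (\bigcup_(A in F) A) b by move=> FA b Ab; exists A.
have fin l : (forall e, List.In e l -> (\bigcup_(A in F) A) e) ->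
    exists A, F A /\ forall e, List.In e l -> A e.
  elim: l => [|e l IH] h; first by exists A0.
  have [|A [FA hA]] := IH; first by move=> b hb; apply: h; right.
  have [|B FB Be] := h e; first by left.
  have [AB|BA] := tot A B FA FB.
    by exists B; split=> // b [<-//|/hA/AB].
  by exists A; split=> // b [<-|/hA//]; apply: BA.
have finP P : dfn (\bigcup_(A in F) A) P -> exists A, F A /\ dfn A P.
  move=> /dfn_finite[l [hl hP]]; have [A [FA hA]] := fin l hl.
  by exists A; split=> //; apply: dfn_mono hP.
split.
- by move=> m; apply: (sub _ FA0); apply: good_base (gF _ FA0) m.
- move=> X /finP[A [FA hX]]; apply: tame_mono (good_tame (gF _ FA) hX); exact: sub.
- move=> x y [A FA Ax] [B FB By] xy; have [AB|BA] := tot A B FA FB.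
    by apply: good_dense (gF _ FB) _ _ (AB _ Ax) By xy.
  by apply: good_dense (gF _ FA) _ _ Ax (BA _ By) xy.
- by move=> x [A FA Ax]; apply: good_unbounded (gF _ FA) _ Ax.
- by move=> P /finP[A [FA hP]]; apply: good_trace (gF _ FA) _ hP.
Qed.

Lemma maximal_good : exists A, good A /\ forall B, good B -> (forall b, A b -> B b) -> forall b, B b -> A b.
Proof.
have [F Fsub tot|A [hA maxA]] := @Zorn_bigcup S (fun A => A = classical_sets.set0 \/ good A).
  have [[A [FA gA]]|n] := pselect (exists A, F A /\ good A); last first.
    left; rewrite -subset0 => b [A FA Ab]; case: (Fsub A FA) => [E|gA]; first by rewrite E in Ab.
    by case: n; exists A.
  right.
  have -> : \bigcup_(X in F) X = \bigcup_(X in fun B => F B /\ good B) X.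
    rewrite eqEsubset; split=> b [B FB Bb]; last by exists B => //; case: FB.
    exists B => //; split=> //; case: (Fsub B FB) => // E; by rewrite E in Bb.
  apply: good_chain; first by exists A.
    by move=> B [].
  by move=> B D [FB _] [FD _]; apply: tot.
have gA : good A.
  case: hA => // E; case: (maxA im); last by right; apply: good_image.
  rewrite E; split=> [//|/(_ (j zero))]; apply; exact: (ex_intro _ zero erefl).
exists A; split=> // B gB AB b Bb; apply: contrapT => nA.
by apply: (maxA B); [split=> // BA; apply/nA/BA|right].
Qed.

End MaximalGood.

(** * Nonvaluational expansions are traces *)

Lemma dfn_mix (L : language) (S : structure L) (A : S -> Prop) (P : (nat -> S) -> Prop) (e : nat -> S) :
  (forall k, A (e k)) -> dfn A P -> dfn A (fun x => P (mix x e)).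
Proof.
move=> he [p [d [hd h]]].
pose r k := if odd k then k./2.*2.+1.*2.+1 else
  if odd k./2 then k./2./2.*2.*2.+1 else k./2./2.*2.
pose E k := if odd k then d k./2 else e k./2.
exists (fren r p), E; split=> [k|x]; first by rewrite /E; case: ifP.
rewrite h sat_fren.
suff -> : mix (mix x e) d = (fun k => mix x E (r k)) by [].
apply: funext => k; rewrite /r {1}/mix; case: ifP => hk.
  by rewrite mix_odd /E /= odd_double uphalf_double.
rewrite /mix; case: ifP => hk2.
  by rewrite /= odd_double uphalf_double /E odd_double doubleK.
by rewrite odd_double doubleK.
Qed.

Lemma dfn_of_sat (L1 L2 : language) (S : structure L2) lt1 fint1 rint1
    (S1 := @Structure L1 S lt1 fint1 rint1) :
  (forall p, dfn (fun _ : S => True) (fun x => @sat L1 S1 x p)) ->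
  forall P : (nat -> S) -> Prop, @dfn L1 S1 (fun _ => True) P -> @dfn L2 S (fun _ => True) P.
Proof.
move=> h P [p [e [_ hP]]]; have := @dfn_mix _ S _ _ e (fun _ => I) (h p).
by apply: dfn_ext => x; rewrite hP.
Qed.

Section NonValuational.
Variables (L : language) (M : structure L) (plus : func L 2) (zero : M) (opp : M -> M).
Hypothesis hg : ordered_group (@lt L M) (binop plus) zero opp.
Hypothesis nv : ~ valuational (binop plus) zero opp.
Local Notation "x + y" := (binop plus x y).
Local Notation "x < y" := (lt x y).

(* The stabilizer of a definable cut is a definable convex subgroup. *)
Lemma cut_shift (P : M -> Prop) : dfn1 (fun _ => True) P ->
  (forall x y, x < y -> P y -> P x) -> (exists x, P x) -> (exists x, ~ P x) ->
  forall e, zero < e -> exists p, P p /\ ~ P (p + e).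
Proof.
move=> dP low [p Pp] [q nPq] e e0; apply: contrapT => H; apply: nv.
have inh : exists a : M, True by exists zero.
exists (fun h => forall x, P x <-> P (x + h)); split.
  by apply/definable1_dfn; defin.
split=> [x y z hx hz xy yz w|].
  split=> [/hz|] Pw; first by apply: low Pw; apply/(ltD2l hg).
  by apply/hx; apply: low Pw; apply/(ltD2l hg).
split; first split=> [x|]; first by rewrite (addr0 hg).
  split=> [x y hx hy w|x hx w]; first by rewrite hx hy (og_addA hg).
  by rewrite (hx (w + opp x)) (addrNK hg).
split; last by exists (opp p + q) => /(_ p); rewrite (addNKr hg) => -[/(_ Pp)].
exists e; split; last by move=> E; apply: (og_irrefl hg (x := zero)); rewrite -{2}E.
move=> x; split=> Px; first by apply: contrapT => n; apply: H; exists x.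
by apply: low Px; apply/(lt_addr_pos hg).
Qed.

(** The distance from [u] to [v] crosses the cut from some [p] in [C]. As [C] has no maximum, a
    point of [C] lies strictly between [p] and its translate, and it is moved between [u] and
    [v]. *)
Lemma nonvaluational_dense (C : M -> Prop) : is_cut (@lt L M) C -> dfn1 (fun _ => True) C ->
  (exists x, C x) -> (exists x, ~ C x) ->
  forall x y : M, x < y -> exists z, x < z /\ z < y.
Proof.
move=> [cut nomax] dC exC exnC u v uv; apply: contrapT => n.
have e0 : zero < opp u + v by apply/(lt_addr_pos hg u); rewrite (addNKr hg).
have low x y : x < y -> C y -> C x.
  move=> xy Cy; apply: contrapT => nCx.
  by apply: (og_irrefl hg (x := x)); apply: (og_trans hg xy); apply: cut.
have [p [Cp nCp]] := cut_shift dC low exC exnC e0.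
have [y [Cy py]] := nomax p Cp; have yp := cut y _ Cy nCp.
apply: n; exists (u + (opp p + y)); split.
  by apply/(lt_addr_pos hg)/(lt_addr_pos hg p); rewrite (addNKr hg).
by rewrite -(addNKr hg u v); apply/(ltD2l hg)/(ltD2l hg p); rewrite (addNKr hg).
Qed.

End NonValuational.

Lemma sub_push (L : language) (S : structure L) (A : S -> Prop) (inhA : exists a, A a) (tvA : tv A)
    (P : (nat -> substr inhA tvA) -> Prop) : dfn (fun _ => True) P ->
  exists Q, dfn A Q /\ forall x, P x <-> Q (fun k => sub_val (x k)).
Proof.
move=> [p [e [_ h]]].
exists (fun y => sat (mix y (fun k => sub_val (e k))) p); split.
  by exists p, (fun k => sub_val (e k)); split=> // k; apply: sub_val_in.
move=> x; rewrite h (@sub_elementary L S A inhA tvA p).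
suff -> : (fun k => sub_val (mix x e k)) = mix (fun k => sub_val (x k)) (fun k => sub_val (e k)) by [].
by apply: funext => k; rewrite /mix; case: ifP.
Qed.

(** Selects the sublanguage without the cut symbols, whose reduct of the expansion is M again. *)
Definition old_rel (L : language) (I : Type) n (r : cut_rel L I n) : Prop :=
  if r is OldRel _ _ then True else False.

Lemma old_relP (L : language) (M : structure L) (I : Type) (C : I -> M -> Prop) n
    (r : cut_rel L I n) :
  old_rel r -> exists r0 : Defs.rel L n, cut_rint C r = @rint L M n r0.
Proof. by case: n / r => [n r0|//] _; exists r0. Qed.

Lemma nonvaluational_trace (L : language) (M : structure L)
    (plus : func L 2) (zero : M) (opp : M -> M)
    (hgroup : ordered_group (@lt L M) (binop plus) zero opp)
    (hmin : o_minimal M)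
    (I : Type) (C : I -> M -> Prop)
    (hcut : forall i, is_cut (@lt L M) (C i))
    (hproper : exists i, ~ definable1 (C i)) :
  ~ @valuational _ (expansion_by_cuts C) (binop plus) zero opp ->
  o_minimal_trace (expansion_by_cuts C).
Proof.
move=> nv; pose M' := expansion_by_cuts C.
pose F0 n (f : func (cut_language L I) n) := True.
pose M0 := reduct M' F0 (@old_rel L I).
pose plus0 : func (sublanguage F0 (@old_rel L I)) 2 := exist _ plus Logic.I.
have inhM : exists a : M, True by exists zero.
have inhM' : exists a : M', True by exists zero.
have hg0 : ordered_group (@lt _ M0) (@binop _ M0 plus0) zero opp by exact: hgroup.
have hg' : ordered_group (@lt _ M') (@binop _ M' plus) zero opp by exact: hgroup.
pose L0 := sublanguage F0 (@old_rel L I).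
pose fint0 n (f : func L0 n) := @fint L M n (sval f).
pose rint0 n (r : Defs.rel L0 n) := cut_rint C (sval r).
have dfnM P : @dfn _ M0 (fun _ => True) P -> @dfn _ M (fun _ => True) P.
  apply: (@dfn_of_sat L0 L M (@lt L M) fint0 rint0); apply: (@dfn_interp _ L M) => //.
  - by apply: (@dfn_lt L M); apply: dfun_var.
  - move=> n f; apply: (@dfn_eq L M); first exact: dfun_var.
    by apply: (@dfun_app L M _ n (sval f)) => // i; apply: dfun_var.
  - move=> n r; rewrite /rint0; have [r0 ->] := old_relP C (svalP r).
    by apply: (@dfn_rel L M) => // i; apply: dfun_var.
have dfnM' P : @dfn _ M0 (fun _ => True) P -> @dfn _ M' (fun _ => True) P.
  apply: (@dfn_of_sat L0 _ M' (@lt L M) fint0 rint0); apply: (@dfn_interp _ _ M') => //.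
  - by apply: (@dfn_lt _ M'); apply: dfun_var.
  - move=> n f; apply: (@dfn_eq _ M'); first exact: dfun_var.
    by apply: (@dfun_app _ M' _ n (sval f)) => // i; apply: dfun_var.
  - by move=> n r; apply: (@dfn_rel _ M' _ n (sval r)) => // i; apply: dfun_var.
have min0 : o_minimal M0.
  move=> X /definable1_dfn/dfnM/(omin_tame hgroup hmin) hX.
  by have [s [_ hs]] := tame_pieces hg0 (hX : @tame _ M0 _ X); exists s.
have dC i : @dfn1 _ M' (fun _ => True) (C i).
  have := @dfn_rel _ M' (fun _ => True) 1 (CutRel L i) (fun k x => x k) inhM'.
  by apply=> k; apply: dfun_var.
have proper i : ~ definable1 (C i) -> (exists x, C i x) /\ (exists x, ~ C i x).
  move=> nd; split; apply: contrapT => n; apply: nd; apply/definable1_dfn.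
    apply: dfn_ext (dfn_bot inhM) => x; split=> // Cx; case: n; by exists (x 0).
  apply: dfn_ext (dfn_prop True inhM) => x; split=> // _; apply: contrapT => nC.
  by case: n; exists (x 0).
have [i0 nd0] := hproper; have [exC0 exnC0] := proper i0 nd0.
have dense0 := nonvaluational_dense hg' nv (hcut i0) (dC i0) exC0 exnC0.
have [nomin0 nomax0] : (forall x : M0, exists y, lt y x) /\ (forall x : M0, exists y, lt x y).
  have [x Cx] := exC0; have [y [_ xy]] := (hcut i0).2 x Cx.
  apply: (unbounded hg0 (e := binop plus (opp x) y)).
  by apply/(lt_addr_pos hgroup x); rewrite (addNKr hgroup).
have nv0 := cut_shift hg' nv.
have [S [j [hj real]]] := @cuts_realized _ M0 (og_trans hgroup) (og_total hgroup).
have validS p : (forall e : nat -> M0, sat e p) -> forall e : nat -> S, sat e p.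
  by move=> h; apply: (iffLR (elementary_valid hj p (zero : M0)) h).
have [zeroS [oppS hgS]] := ordered_group_transfer validS (j zero) hg0.
have denseS := dense_transfer validS dense0.
have [nominS nomaxS] := unbounded_transfer validS (conj nomin0 nomax0).
have [A [gA maxA]] := maximal_good hg0 min0 dense0 nomin0 nomax0 hj dfnM'.
pose inhA := good_inhab (zero : M0) gA; pose tvA := good_tv (zero : M0) hgS gA.
have realized i : (exists x, C i x) -> (exists x, ~ C i x) ->
    exists b, A b /\ forall m, C i m <-> lt (j m) b.
  move=> exC exnC; apply: contrapT => n.
  have [a [below above]] := real (C i) (hcut i) exC.
  have nr b : A b -> ~ forall m, C i m <-> lt (j m) b by move=> Ab h; apply: n; exists b.
  have gB := extend_good hg0 dense0 hj hgS denseS nominS nomaxS nv0 gA (dC i) (hcut i)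
    exC exnC below above nr.
  have Aa : A a.
    apply: (maxA _ gB); last by apply: dcl_sub; right.
    by move=> b Ab; apply: dcl_sub; left.
  apply: (nr a Aa) => m; split=> [/below//|ma]; apply: contrapT => /above am.
  by apply: (og_irrefl hgS (x := a)); apply: (og_trans hgS am ma).
pose N := substr inhA tvA; pose val : N -> S := @sub_val L0 S A inhA tvA.
have valE : elementary val by exact: sub_elementary.
pose jN (m : M0) : N := exist _ (j m) (good_base gA m).
have jNE : elementary jN.
  by move=> p e; rewrite (hj p e) (valE p).
have realN i : (exists x, C i x) -> (exists x, ~ C i x) ->
    exists b : N, forall m, C i m <-> lt (jN m) b.
  by move=> h /(realized i h)[b [Ab hb]]; exists (exist _ b Ab).
have inhT : exists a : trace_expansion jN, True by exists zero.
exists F0, (@old_rel L I), N, jN; split; last split; last split; last split; last split.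
- by have [z' [o' hN]] := sub_group (zero : M0) hgS gA; exists plus0, z', o'.
- exact: sub_o_minimal.
(* If the realization [b] of the nondefinable cut came from M, it would define that cut. *)
- have [b hb] := realN i0 exC0 exnC0; exists b => x E; apply: nd0; apply/definable1_dfn.
  have : @dfn _ M0 (fun _ => True) (fun v => lt (v 0) x).
    by apply: (@dfn_lt _ M0); [exact: dfun_var|exact: dcl_sub].
  move/dfnM; apply: dfn_ext => v; rewrite hb -E.
  exact: (elementary_lt jNE).
- move=> x y xy.
  by have [m hm] := good_dense gA (sub_val_in x) (sub_val_in y) xy; exists m.
- exact: jNE.
move=> n X; rewrite (@definable_dfn _ M') (@definable_dfn _ (trace_expansion jN)); split.
- pose T := trace_expansion jN.
  apply: (@dfn_of_sat (cut_language L I) _ T (@lt L M) (@fint L M) (cut_rint C)).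
  apply: (@dfn_interp _ _ T) => //.
  + by apply: (@dfn_lt _ T); apply: dfun_var.
  + move=> k f; apply: (@dfn_eq _ T); first exact: dfun_var.
    by apply: (@dfun_app _ T _ k (exist _ f Logic.I)) => // i; apply: dfun_var.
  + move=> k r; case: k / r => [k r|i].
      by apply: (@dfn_rel _ T _ k (inl (exist _ (OldRel I r) Logic.I))) => // l; apply: dfun_var.
    (* An empty or full cut has no realization in N to rely on, but is definable outright. *)
    have [exC|nC] := pselect (exists x, C i x); last first.
      by apply: dfn_ext (dfn_bot inhT) => x; split=> // Cx; apply: nC; exists (x 0).
    have [exnC|nnC] := pselect (exists x, ~ C i x); last first.
      apply: dfn_ext (dfn_prop True inhT) => x; split=> // _; apply: contrapT => nCx.
      by apply: nnC; exists (x 0).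
    have [b hb] := realN i exC exnC.
    have hD : definable (fun x : 'I_1 -> N => lt (x ord0) b).
      apply/definable_dfn; apply: (@dfn_lt _ N); last exact: dcl_sub.
      by apply: dfun_var; exists b.
    have := @dfn_rel _ T _ 1 (inr (exist _ _ hD)) (fun k x => x k) inhT.
    have hv (l : 'I_1) : dfun (fun _ : T => True) (fun x => x l) by apply: dfun_var.
    by move/(_ hv); apply: dfn_ext => x; rewrite /= hb.
- pose T := trace_expansion jN.
  apply: (@dfn_of_sat (trace_language N) _ M' (@lt L M) (@fint _ T) (@rint _ T)).
  apply: (@dfn_interp _ _ M') => //.
  + by apply: (@dfn_lt _ M'); apply: dfun_var.
  + move=> k f; apply: (@dfn_eq _ M'); first exact: dfun_var.
    by apply: (@dfun_app _ M' _ k (sval f)) => // i; apply: dfun_var.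
  + move=> k [r|[D hD]].
      by apply: (@dfn_rel _ M' _ k (sval r)) => // i; apply: dfun_var.
    have /definable_dfn/sub_push[Q [hQ DQ]] := hD.
    by apply: dfn_ext (good_trace gA hQ) => x; rewrite -(DQ (fun k => jN (x k))).
Qed.

Theorem proposition1 (L : language) (M : structure L)
    (plus : func L 2) (zero : M) (opp : M -> M)
    (hgroup : ordered_group (@lt L M) (binop plus) zero opp)
    (hmin : o_minimal M)
    (I : Type) (C : I -> M -> Prop)
    (hcut : forall i, is_cut (@lt L M) (C i))
    (hproper : exists i, ~ definable1 (C i)) :
  ~ @valuational _ (expansion_by_cuts C) (binop plus) zero opp <->
  o_minimal_trace (expansion_by_cuts C).
Proof.
split; first exact: nonvaluational_trace.
exact: trace_not_valuational.
Qed.
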